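(* Let $(\mathcal{X},d)$ be a Polish space and $\mu\in\mathcal{P}(\mathcal{X})$. Suppose that for some constants $\lambda_o,D>0$, $H(\nu|\mu)\le D\,I(\nu|\mu)$ holds for every probability measure $\nu$ of the form $\nu(dx)=e^{f(x)}\mu(dx)$ with $f\in\mathcal{F}_{\lambda_o}(\mathcal{X})$. Then $\mu$ satisfies $\mathbf{T}_2(\max(4D,1/\lambda_o))$.
   Context: $\mathcal{F}_{\lambda_o}(\mathcal{X})$ is the set of functions $f:\mathcal{X}\to\mathbb{R}$ for which there exist $g:\mathcal{X}\to\mathbb{R}$ and $\lambda\in(0,\lambda_o)$ with $f(x)=\inf_{y\in\mathcal{X}}\{-g(y)+\lambda d^2(x,y)\}$ for all $x$. $H(\nu|\mu)=\int\log(d\nu/d\mu)\,d\nu$ for $\nu\ll\mu$ ($+\infty$ otherwise). The Fisher information is $I(\nu|\mu)=\int|\nabla^+\log(d\nu/d\mu)|^2\,d\nu$, where the local slope is $|\nabla^+g|(x)=\limsup_{y\to x}[g(y)-g(x)]_+/d(y,x)$ ($0$ at isolated points). $\mu$ satisfies $\mathbf{T}_2(C)$ if $W_2^2(\nu,\mu)\le C\,H(\nu|\mu)$ for all $\nu\in\mathcal{P}(\mathcal{X})$, with $W_2^2(\nu,\mu)=\inf_\pi\iint d^2\,d\pi$ over couplings of $\nu$ and $\mu$. *)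

(* Defs.v *)
From HB Require Import structures.
From mathcomp Require Import all_boot all_order all_algebra.
From mathcomp Require Import all_classical all_reals all_analysis.
Set Implicit Arguments. Unset Strict Implicit. Unset Printing Implicit Defensive.
Import Order.TTheory GRing.Theory Num.Theory.
Local Open Scope classical_set_scope.
Local Open Scope ring_scope.

Section Defs.
Context (R : realType) (dd : measure_display) (X : measurableType dd).
Variable (d : X -> X -> R).

Definition is_metric : Prop :=
  [/\ forall x y, 0 <= d x y,
      forall x y, d x y = 0 <-> x = y,
      forall x y, d x y = d y x &
      forall x y z, d x z <= d x y + d y z].

Definition dopen (A : set X) : Prop :=
  forall x, A x -> exists r : R, 0 < r /\ forall y, d x y < r -> A y.

Definition dcomplete : Prop :=
  forall u : nat -> X,
    (forall e : R, 0 < e -> exists N, forall m n, (N <= m)%N -> (N <= n)%N ->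
        d (u m) (u n) < e) ->
    exists l, forall e : R, 0 < e -> exists N, forall n, (N <= n)%N -> d (u n) l < e.

Definition dseparable : Prop :=
  exists S : set X, countable S /\
    forall x (e : R), 0 < e -> exists s, S s /\ d x s < e.

Definition polish_borel : Prop :=
  [/\ is_metric, dcomplete, dseparable &
      forall A : set X, measurable A <-> <<s dopen >> A].

Definition inF (lam0 : R) (f : X -> R) : Prop :=
  exists (g : X -> R) (lam : R), 0 < lam < lam0 /\
    forall x, (f x)%:E = ereal_inf [set (- g y + lam * d x y ^+ 2)%:E | y in [set: X]].

(* local slope |grad^+ g|(x) = limsup_{y -> x} [g y - g x]_+ / d(y,x), 0 at isolated points *)
Definition slope (g : X -> R) (x : X) : \bar R :=
  ereal_inf [set ereal_sup ([set 0%E] `|`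
      [set ((Num.max (g y - g x) 0) / d y x)%:E | y in [set y | 0 < d y x < r]])
    | r in [set r : R | 0 < r]].

(* relative entropy H(nu|mu) = \int (dnu/dmu) log (dnu/dmu) dmu if nu << mu, +oo otherwise;
   as an infimum over (a.e. equal) densities, +oo if there is no density *)
Definition is_density (mu nu : {measure set X -> \bar R}) (g : X -> R) : Prop :=
  [/\ measurable_fun [set: X] g, forall x, 0 <= g x &
      forall A, measurable A -> (nu A = \int[mu]_(x in A) (g x)%:E)%E].

Definition relent (mu nu : {measure set X -> \bar R}) : \bar R :=
  ereal_inf [set (\int[mu]_x (g x * ln (g x))%:E)%E | g in is_density mu nu].

(* Fisher information of nu = e^f mu w.r.t. mu: \int |grad^+ f|^2 dnu *)
Definition fisher (mu : {measure set X -> \bar R}) (f : X -> R) : \bar R :=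
  \int[mu]_x ((slope f x) ^+ 2 * (expR (f x))%:E)%E.

Definition coupling (nu mu : set X -> \bar R) (pi : set (X * X) -> \bar R) : Prop :=
  forall A B : set X, measurable A -> measurable B ->
    (pi (A `*` [set: X]) = nu A)%E /\ (pi ([set: X] `*` B) = mu B)%E.

Definition W2sq (nu mu : probability X R) : \bar R :=
  ereal_inf [set (\int[pi]_z (d z.1 z.2 ^+ 2)%:E)%E
    | pi in [set pi : probability (X * X)%type R | coupling nu mu pi]].

Definition T2 (mu : probability X R) (C : R) : Prop :=
  forall nu : probability X R, (W2sq nu mu <= C%:E * relent mu nu)%E.

End Defs.

(* Main.v *)
(** Fix [lam < lam0] with [4 D lam <= 1] and a bounded measurable [h], and put
    [f_k x = inf_y (k h y + lam d(x,y)^2)], [L k = ln \int e^(f_k) dmu].  A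
    near-minimiser [y] at [x] satisfies [lam d(x,y)^2 <= S], where
    [S = (k' f_k x - k f_k' x) / (k' - k)] and [k < k'], while the slope of [f_k]
    at [x] is at most [2 lam d(x,y)]; hence the squared slope is at most [4 lam S].
    The restricted log-Sobolev inequality for [e^(f_k - L k) mu] then says that
    [L k / k] is nonincreasing up to a quadratic error, and letting [k] run from
    [0] to [1] gives [\int e^(f_1) dmu <= e^(\int h dmu)].

    By the Gibbs inequality, [\int phi dnu - \int h dmu <= H(nu|mu)] as soon as
    [phi x <= h y + lam d(x,y)^2].  It remains to build couplings of cost close to
    the supremum of these dual values.  The exponential bound yields finite second
    moments, so both measures may be quantised on finitely many cells.  On the
    cells, the maximiser of the entropically regularised dual problem produces an
    almost optimal transport plan, and spreading its weights as products of
    conditional measures gives a coupling of [nu] and [mu]. *)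

Require Import Defs.
From HB Require Import structures.
From mathcomp Require Import all_boot all_order all_algebra.
From mathcomp Require Import all_classical all_reals all_analysis.
From mathcomp Require Import measurable_realfun ring lra.
Import Order.TTheory GRing.Theory Num.Theory.
Local Open Scope classical_set_scope.
Local Open Scope ring_scope.
Import numFieldNormedType.Exports.
Set Implicit Arguments.
Unset Strict Implicit.
Unset Printing Implicit Defensive.

(** * Finite optimal transport: entropic duality *)

(** Since [1 - x <= e^(-x)], [e^x (1 - x) <= 1]; and [(1 - x)(1 + x + 2 x^2) = 1 + x^2 (1 - 2 x) >=
    1] for [x <= 1/2]. *)
Lemma expR_le_quadratic (R : realType) (x : R) :
  x <= 1/2 -> expR x <= 1 + x + 2 * x ^+ 2.
Proof.
move=> x12; have e0 := expR_gt0 x.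
have : expR x * (1 - x) <= 1.
  have h := expR_ge1Dx (- x); rewrite -[leRHS](mulfV (lt0r_neq0 e0)).
  by rewrite ler_pM2l// -expRN.
nra.
Qed.

(** A first order condition without derivatives: [s (e^t - 1) - a t] is minimal at [t = 0], so its
    slope [s - a] there vanishes. The quadratic bound at [t] and [- t] makes this quantitative. *)
Lemma eq_of_exp_bound (R : realType) (a s : R) : 0 <= s ->
  (forall t, a * t <= s * (expR t - 1)) -> a = s.
Proof.
move=> s0 h.
have bnd t : 0 < t -> t <= 1/2 -> `|a - s| <= 2 * s * t.
  move=> t0 t1; rewrite ler_norml.
  have h1 := h t; have h2 := h (- t).
  have q1 := expR_le_quadratic t1.
  have q2 : expR (- t) <= 1 - t + 2 * t ^+ 2.
    by rewrite -(sqrrN t); apply: expR_le_quadratic; lra.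
  have k1 : a * t <= s * (t + 2 * t ^+ 2) by nra.
  have k2 : a * - t <= s * (- t + 2 * t ^+ 2) by nra.
  apply/andP; split; rewrite -(ler_pM2r t0); nra.
apply/eqP; rewrite -subr_eq0 -normr_le0; apply/ler_addgt0Pl => e e0; rewrite addr0.
have p : 0 < 2 * s + 1 + 2 * e by lra.
have t0 : 0 < e / (2 * s + 1 + 2 * e) by rewrite divr_gt0.
apply: (le_trans (bnd _ t0 _)).
  by rewrite ler_pdivrMr//; lra.
by rewrite mulrA ler_pdivrMr//; nra.
Qed.

Lemma continuous_sum (R : realType) (T : topologicalType) (I : Type)
    (r : seq I) (P : pred I) (F : I -> T -> R) :
  (forall i, P i -> continuous (F i)) ->
  continuous (fun x => \sum_(i <- r | P i) F i x).
Proof.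
move=> cF x; elim: r => [|i r IH].
  by rewrite /continuous_at big_nil; under eq_cvg do rewrite big_nil; exact: cvg_cst.
rewrite /continuous_at big_cons; under eq_cvg do rewrite big_cons.
by case: ifPn => // Pi; apply: cvgD => //; exact: cF.
Qed.

Section finite_duality.
Context (R : realType) (m n : nat).
Variables (a : 'I_m -> R) (b : 'I_n -> R) (c : 'I_m -> 'I_n -> R) (e : R).
Hypotheses (e0 : 0 < e) (a0 : forall i, 0 <= a i) (b0 : forall j, 0 <= b j).
Hypotheses (suma : \sum_i a i = 1) (sumb : \sum_j b j = 1).
Hypothesis (c0 : forall i j, 0 <= c i j).

Let al i j := a i * b j.

Let al0 i j : 0 <= al i j. Proof. exact: mulr_ge0. Qed.

Let al1 i j : al i j <= 1.
Proof.
have ai : a i <= 1 by rewrite -suma (bigD1 i)//= lerDl sumr_ge0.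
have bj : b j <= 1 by rewrite -sumb (bigD1 j)//= lerDl sumr_ge0.
by rewrite /al; have := a0 i; have := b0 j; nra.
Qed.

(** The Gibbs weight of a pair, chosen so that the derivative of [e * plan] in [s] is [plan].
    Cutting it off where [al] vanishes keeps null coordinates out of the maximisation. *)
Let plan i j s := if 0 < al i j then expR ((s - c i j) / e) else 0.

Let plan_ge0 i j s : 0 <= plan i j s.
Proof. by rewrite /plan; case: ifP => // _; exact: expR_ge0. Qed.

Let term i j s := al i j * s - e * plan i j s.

Let term_le i j s : term i j s <= c i j.
Proof.
rewrite /term /plan; case: ifPn => [p|]; last first.
  rewrite -leNgt => q; have -> : al i j = 0 by apply/eqP; rewrite eq_le q al0.
  by rewrite mul0r mulr0 subr0 c0.
have h := expR_ge1Dx ((s - c i j) / e).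
set x := (s - c i j) / e in h *.
have -> : s = c i j + e * x by rewrite /x mulrCA mulfV ?gt_eqF// mulr1 addrC subrK.
have al1' := al1 i j; have c0' := c0 i j.
have k : al i j * x <= expR x.
  by have [x0|x0] := leP 0 x; have := expR_gt0 x; nra.
have := ler_wpM2l (ltW e0) k; nra.
Qed.

(** The linear part bounds [s] from below and the exponential, through [2 x <= e^x], bounds it from
    above. *)
Let term_coercive i j s L : 0 <= L -> 0 < al i j -> - L <= term i j s ->
  `|s| <= 2 * c i j + L + L / al i j.
Proof.
move=> L0 p; rewrite /term /plan p => h.
have c0' := c0 i j; have al1' := al1 i j.
have q0 : 0 <= L / al i j by rewrite divr_ge0// ltW.
rewrite ler_norml; apply/andP; split.
  have : - L <= al i j * s.
    by apply: (le_trans h); rewrite lerBlDr lerDl mulr_ge0 ?expR_ge0// ltW.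
  move=> k; apply: (@le_trans _ _ (- (L / al i j))); first lra.
  by rewrite -mulNr ler_pdivrMr//; lra.
move: h; set x := (s - c i j) / e.
have sE : s = c i j + e * x by rewrite /x mulrCA mulfV ?gt_eqF// mulr1 addrC subrK.
have [x0|x0] := leP 0 x; last first.
  by have : e * x < 0; [rewrite pmulr_rlt0|rewrite sE; lra].
have k : 2 * x <= expR x.
  have h2 := expR_ge1Dx (x / 2); have -> : expR x = expR (x / 2) * expR (x / 2).
    by rewrite -expRD -splitr.
  have : (1 + x / 2) * (1 + x / 2) <= expR (x / 2) * expR (x / 2).
    by apply: ler_pM => //; lra.
  have := sqr_ge0 (1 - x / 2); lra.
rewrite sE => h.
have k1 := ler_wpM2l (ltW e0) k.
have ex0 : 0 <= e * x by rewrite mulr_ge0// ltW.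
nra.
Qed.

Let J (u : 'I_m -> R) (w : 'I_n -> R) := \sum_i \sum_j term i j (u i - w j).

Let exa : exists i, 0 < a i.
Proof.
apply: contrapT => /forallNP h; have : (\sum_i a i) <= 0.
  by apply: sumr_le0 => i _; rewrite leNgt; apply/negP/h.
by rewrite suma leNgt ltr01.
Qed.

Let exb : exists j, 0 < b j.
Proof.
apply: contrapT => /forallNP h; have : (\sum_j b j) <= 0.
  by apply: sumr_le0 => i _; rewrite leNgt; apply/negP/h.
by rewrite sumb leNgt ltr01.
Qed.

Let J_continuous :
  continuous (fun v : 'rV[R]_m * 'rV[R]_n => J (v.1 ord0) (v.2 ord0)).
Proof.
apply: continuous_sum => i _; apply: continuous_sum => j _ v.
have cs : (fun z : 'rV[R]_m * 'rV[R]_n => z.1 ord0 i - z.2 ord0 j) @ v -->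
    v.1 ord0 i - v.2 ord0 j.
  apply: cvgB.
    apply: (@continuous_comp _ _ _ fst (fun z : 'rV[R]_m => z ord0 i) v).
      exact: cvg_fst.
    exact: coord_continuous.
  apply: (@continuous_comp _ _ _ snd (fun z : 'rV[R]_n => z ord0 j) v).
    exact: cvg_snd.
  exact: coord_continuous.
rewrite /term; apply: cvgB; first by apply: cvgM => //; exact: cvg_cst.
apply: cvgM; first exact: cvg_cst.
rewrite /plan; case: ifP => _; last exact: cvg_cst.
apply: continuous_cvg; first exact: continuous_expR.
by apply: cvgM; [apply: cvgB => //|]; exact: cvg_cst.
Qed.

(** A competitor that beats the origin has all its differences [u i - w j] bounded on the support of
    [al]. After normalisation it lies in a fixed compact box, on which the continuous [J] attains
    its maximum. *)
Let J_max : exists u w, forall u' w', J u' w' <= J u w.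
Proof.
have [i0 ai0] := exa; have [j0 bj0] := exb.
(* If [J u w >= J 0 0], every single term is at least [- L], because the others are at most their
   costs. *)
pose L := - J (fun _ => 0) (fun _ => 0) + \sum_i \sum_j c i j.
have sc0 : 0 <= \sum_i \sum_j c i j by apply: sumr_ge0 => i _; exact: sumr_ge0.
have L0 : 0 <= L.
  rewrite addr_ge0// oppr_ge0 sumr_le0// => i _; rewrite sumr_le0// => j _.
  by rewrite /term subr0 mulr0 add0r oppr_le0 mulr_ge0// ltW.
pose Bd i j := 2 * c i j + L + L / al i j.
have Bd0 i j : 0 <= Bd i j.
  have q0 : 0 <= L / al i j by rewrite divr_ge0.
  by rewrite /Bd; have := c0 i j; lra.
(* The factor 2 is there because [w j - w j0] is a difference of two bounded quantities. *)
pose B := 2 * \sum_i \sum_j Bd i j.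
have BdB i j : Bd i j * 2 <= B.
  rewrite mulrC /B ler_pM2l// (bigD1 i)//= (bigD1 j)//= -addrA lerDl.
  by rewrite addr_ge0 ?sumr_ge0// => ? _; rewrite sumr_ge0.
have B0 : 0 <= B by have := BdB i0 j0; have := Bd0 i0 j0; lra.
pose K : set ('rV[R]_m * 'rV[R]_n) :=
  [set v : 'rV[R]_m | forall i, `[- B, B]%classic (v ord0 i)] `*`
  [set v : 'rV[R]_n | forall i, `[- B, B]%classic (v ord0 i)].
have cK : compact K.
  apply: compact_setX.
    by apply: (@rV_compact R m (fun=> `[- B, B]%classic)) => ?; exact: segment_compact.
  by apply: (@rV_compact R n (fun=> `[- B, B]%classic)) => ?; exact: segment_compact.
have K0 : K (0, 0) by split => i /=; rewrite mxE in_itv/=; lra.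
have [v Kv vmax] := @compact_EVT_max _ R _ K (ex_intro _ _ K0) cK
  (continuous_subspaceT J_continuous).
exists (v.1 ord0), (v.2 ord0) => u w.
have [lt|ge] := ltP (J u w) (J (fun _ => 0) (fun _ => 0)).
  apply: (le_trans (ltW lt)); have := vmax _ (mem_set K0).
  congr (_ <= _); congr J; by apply/funext => k; rewrite mxE.
have sb i j : 0 < al i j -> `|u i - w j| <= Bd i j.
  move=> p; apply: term_coercive => //.
  have : J u w <= term i j (u i - w j) + \sum_i \sum_j c i j.
    rewrite /J (bigD1 i)//= (bigD1 j)//= -addrA lerD2l.
    apply: (@le_trans _ _ (\sum_(j1 | j1 != j) c i j1 + \sum_(i1 | i1 != i) \sum_j c i1 j)).
      by rewrite lerD ?ler_sum// => k _; apply: ler_sum => k' _; exact: term_le.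
    by rewrite [leRHS](bigD1 i)//= [\sum_j c i j](bigD1 j)//= -addrA lerDr.
  rewrite /L; lra.
(* [J] sees only the differences [u i - w j] on the support of [al], so a common shift and a reset
   of the null coordinates leave it unchanged. *)
pose u' : 'rV[R]_m := \row_i if 0 < a i then u i - w j0 else 0.
pose w' : 'rV[R]_n := \row_j if 0 < b j then w j - w j0 else 0.
have -> : J u w = J (u' ord0) (w' ord0).
  apply: eq_bigr => i _; apply: eq_bigr => j _; rewrite !mxE.
  have [ai|ai] := ltP 0 (a i); last first.
    have ai' : a i = 0 by apply/eqP; rewrite eq_le ai a0.
    by rewrite /term /plan /al ai' !mul0r ltxx.
  have [bj|bj] := ltP 0 (b j); last first.
    have bj' : b j = 0 by apply/eqP; rewrite eq_le bj b0.
    by rewrite /term /plan /al bj' !mulr0 ltxx !mul0r.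
  by congr term; lra.
apply: (vmax (u', w')); rewrite inE; split => [i|j] /=; rewrite mxE in_itv/= -ler_norml.
  case: ifPn => [p|_]; last by rewrite normr0.
  have := sb i j0 (mulr_gt0 p bj0); have := BdB i j0; have := Bd0 i j0; lra.
case: ifPn => [p|_]; last by rewrite normr0.
have := sb i0 j0 (mulr_gt0 ai0 bj0); have := BdB i0 j0.
have := sb i0 j (mulr_gt0 ai0 p); have := BdB i0 j.
have := Bd0 i0 j; have := Bd0 i0 j0.
have -> : w j - w j0 = (u i0 - w j0) - (u i0 - w j) by lra.
have := ler_normB (u i0 - w j0) (u i0 - w j); lra.
Qed.

(* A maximiser of the entropically regularised dual functional [J] yields a plan
   with the right marginals, by its first order conditions. *)
Lemma finite_transport_duality_entropic : exists u w p,
  [/\ forall i j, 0 <= p i j,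
      forall i, \sum_j p i j = a i,
      forall j, \sum_i p i j = b j,
      forall i j, u i - w j <= c i j &
      \sum_i \sum_j p i j * c i j <=
        \sum_i u i * a i - \sum_j w j * b j + e * (m * n)%:R].
Proof.
have [u [w opt]] := J_max.
pose p i j := plan i j (u i - w j).
have p0 i j : 0 <= p i j by exact: plan_ge0.
have planD i j s t : plan i j (s + e * t) = plan i j s * expR t.
  rewrite /plan; case: ifP => _; last by rewrite mul0r.
  by rewrite -expRD; congr expR; field; rewrite gt_eqF.
(* Moving [u i] alone by [e * t] cannot increase [J], which reads
   [a i * t <= (\sum_j p i j) (e^t - 1)] for every real [t]. *)
have rowp i : \sum_j p i j = a i.
  apply/esym/eq_of_exp_bound; first exact: sumr_ge0.
  move=> t; have := opt (fun k => if k == i then u i + e * t else u k) w.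
  rewrite /J (bigD1 i)//= eqxx [leRHS](bigD1 i)//=.
  rewrite [X in _ + X <= _](eq_bigr (fun k => \sum_j term k j (u k - w j))); last first.
    by move=> k /negbTE ->.
  rewrite lerD2r -subr_le0 -sumrB => h.
  have : \sum_j (e * (al i j * t - p i j * (expR t - 1))) <= 0.
    apply: le_trans h; apply: ler_sum => j _; rewrite /term.
    have -> : u i + e * t - w j = u i - w j + e * t by lra.
    rewrite planD -/(p i j); nra.
  rewrite -mulr_sumr pmulr_rle0// sumrB -!mulr_suml -mulr_sumr sumb mulr1; lra.
have colp j : \sum_i p i j = b j.
  apply/esym/eq_of_exp_bound; first exact: sumr_ge0.
  move=> t; have := opt u (fun k => if k == j then w j - e * t else w k).
  rewrite /J exchange_big (bigD1 j)//= eqxx [X in _ <= X]exchange_big [leRHS](bigD1 j)//=.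
  rewrite [X in _ + X <= _](eq_bigr (fun k => \sum_i term i k (u i - w k))); last first.
    by move=> k /negbTE ->.
  rewrite lerD2r -subr_le0 -sumrB => h.
  have : \sum_i (e * (al i j * t - p i j * (expR t - 1))) <= 0.
    apply: le_trans h; apply: ler_sum => i _; rewrite /term.
    have -> : u i - (w j - e * t) = u i - w j + e * t by lra.
    rewrite planD -/(p i j); nra.
  rewrite -mulr_sumr pmulr_rle0// sumrB -!mulr_suml suma mul1r; lra.
have alP i j : (0 < al i j) = (0 < a i) && (0 < b j).
  apply/idP/andP => [|[? ?]]; last exact: mulr_gt0.
  rewrite /al lt0r mulf_eq0 negb_or => /andP[/andP[ai bj] _].
  by rewrite !lt0r ai bj a0 b0.
have p1 i j : p i j <= 1.
  apply: (@le_trans _ _ (a i)).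
    by rewrite -(rowp i) (bigD1 j)//= lerDl sumr_ge0.
  by rewrite -suma (bigD1 i)//= lerDl sumr_ge0.
(* The marginals force [p i j <= 1], so the exponent defining [p i j] is nonpositive: this is dual
   feasibility. *)
have uw i j : 0 < al i j -> u i - w j <= c i j.
  move=> q; have := p1 i j; rewrite /p /plan q expR_le1 pmulr_lle0 ?invr_gt0//; lra.
(* At null points the potentials are replaced by [- B] and [B], which extends feasibility to all
   pairs without changing the dual value. *)
pose B := \sum_i `|u i| + \sum_j `|w j|.
have uB i : u i <= B.
  apply: (le_trans (ler_norm _)); rewrite /B (bigD1 i)//= -addrA lerDl.
  by rewrite addr_ge0 ?sumr_ge0.
have wB j : - B <= w j.
  rewrite lerNl; apply: (le_trans (ler_norm _)).
  rewrite normrN; apply: (@le_trans _ _ (\sum_k `|w k|)); last by rewrite lerDr sumr_ge0.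
  by rewrite (bigD1 j)//= lerDl sumr_ge0.
exists (fun i => if 0 < a i then u i else - B), (fun j => if 0 < b j then w j else B), p.
split=> //.
  move=> i j; have := alP i j; have := uw i j; have := uB i; have := wB j; have := c0 i j.
  have B0 : 0 <= B by rewrite /B addr_ge0 ?sumr_ge0.
  by case: (0 < a i); case: (0 < b j) => /= c1 h1 h2 h3 h4; [exact: h3|lra..].
have -> : \sum_i (if 0 < a i then u i else - B) * a i = \sum_i u i * a i.
  apply: eq_bigr => i _; have [//|ai] := ltP 0 (a i).
  have -> : a i = 0 by apply/eqP; rewrite eq_le ai a0.
  by rewrite !mulr0.
have -> : \sum_j (if 0 < b j then w j else B) * b j = \sum_j w j * b j.
  apply: eq_bigr => j _; have [//|bj] := ltP 0 (b j).
  have -> : b j = 0 by apply/eqP; rewrite eq_le bj b0.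
  by rewrite !mulr0.
have -> : \sum_i u i * a i = \sum_i \sum_j p i j * u i.
  by apply: eq_bigr => i _; rewrite -mulr_suml rowp mulrC.
have -> : \sum_j w j * b j = \sum_i \sum_j p i j * w j.
  by rewrite exchange_big; apply: eq_bigr => j _; rewrite -mulr_suml colp mulrC.
have -> : e * (m * n)%:R = \sum_(i < m) \sum_(j < n) e.
  by rewrite !sumr_const !card_ord -mulrnA mulr_natr mulnC.
rewrite -sumrB -big_split/=; apply: ler_sum => i _.
rewrite -sumrB -big_split/=; apply: ler_sum => j _.
(* the entropic error: [- x e^x <= 1] *)
rewrite /p /plan; case: ifP => _; last first.
  by rewrite !mul0r subr0 add0r ltW.
set x := (u i - w j - c i j) / e.
have -> : c i j = u i - w j - e * x by rewrite /x; field; rewrite gt_eqF.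
have k : - x * expR x <= 1.
  rewrite -(@ler_pM2r _ (expR (- x))) ?expR_gt0// -mulrA -expRD subrr expR0.
  have := expR_ge1Dx (- x); lra.
have := ler_wpM2l (ltW e0) k; nra.
Qed.

End finite_duality.

Lemma finite_transport_duality (R : realType) (m n : nat) (a : 'I_m -> R)
    (b : 'I_n -> R) (c : 'I_m -> 'I_n -> R) (e : R) : 0 < e ->
  (forall i, 0 <= a i) -> (forall j, 0 <= b j) ->
  \sum_i a i = 1 -> \sum_j b j = 1 -> (forall i j, 0 <= c i j) ->
  exists u w p,
  [/\ forall i j, 0 <= p i j,
      forall i, \sum_j p i j = a i,
      forall j, \sum_i p i j = b j,
      forall i j, u i - w j <= c i j &
      \sum_i \sum_j p i j * c i j <= \sum_i u i * a i - \sum_j w j * b j + e].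
Proof.
move=> e0 a0 b0 suma sumb c0.
have e'0 : 0 < e / (m * n).+1%:R by rewrite divr_gt0.
have [u [w [p [p0 rp cp uw le]]]] :=
  finite_transport_duality_entropic e'0 a0 b0 suma sumb c0.
exists u, w, p; split=> //; apply: (le_trans le); rewrite lerD2l.
by rewrite -mulrA ger_pMr// mulrC ler_pdivrMr// mul1r ler_nat.
Qed.

(** * Integration against a density *)

(** The integral of a nonnegative function is a supremum over the simple functions below it, so
    monotonicity holds without measurability. This serves for the slope and for [d ^+ 2] on the
    product space. *)
Lemma ge0_le_lower_integral (dd : measure_display) (T : measurableType dd)
    (R : realType) (mu : {measure set T -> \bar R}) (f g : T -> \bar R) :
  (forall x, (0 <= f x)%E) -> (forall x, (f x <= g x)%E) ->
  (\int[mu]_x f x <= \int[mu]_x g x)%E.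
Proof.
move=> f0 fg; have g0 x : (0 <= g x)%E by exact: le_trans (fg x).
rewrite !ge0_integralTE//; apply: ge_ereal_sup => _ [h hf <-].
by apply: ereal_sup_ubound; exists h => // x; exact: le_trans (fg x).
Qed.

(** The entropy integrand is signed and may have infinite integral, so positive and negative parts
    are compared separately. *)
Lemma le_integral_measurable (dd : measure_display) (T : measurableType dd)
    (R : realType) (mu : {measure set T -> \bar R}) (f g : T -> \bar R) :
  measurable_fun [set: T] f -> measurable_fun [set: T] g -> (forall x, (f x <= g x)%E) ->
  (\int[mu]_x f x <= \int[mu]_x g x)%E.
Proof.
move=> mf mg fg; rewrite integralE [leRHS]integralE leeB//; apply: ge0_le_integral => //.
- exact: measurable_funepos.
- exact: measurable_funepos.
- by move=> x _; apply: (@funepos_le _ _ setT); rewrite ?inE// => ? _; exact: fg.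
- exact: measurable_funeneg.
- exact: measurable_funeneg.
- by move=> x _; apply: (@funeneg_le _ _ setT); rewrite ?inE// => ? _; exact: fg.
Qed.

Section density_measure.
Context (dd : measure_display) (T : measurableType dd) (R : realType).
Variables (mu : {measure set T -> \bar R}) (g : T -> R).
Hypotheses (mg : measurable_fun [set: T] g) (g0 : forall x, 0 <= g x).

Let m (A : set T) : \bar R := (\int[mu]_(x in A) (g x)%:E)%E.

Let m0 : m set0 = 0%E. Proof. exact: integral_set0. Qed.

Let m_ge0 A : (0 <= m A)%E.
Proof. by apply: integral_ge0 => x _; rewrite lee_fin. Qed.

Let m_sigma_additive : semi_sigma_additive m.
Proof.
move=> /= F mF tF mUF; rewrite /m; apply: cvg_toP.
  apply: ereal_nondecreasing_is_cvgn => k n kn.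
  by apply: lee_sum_nneg_natr => // i _ _; exact: m_ge0.
rewrite ge0_integral_bigcup//=.
- by apply/measurable_funTS/measurable_EFinP.
- by move=> x _; rewrite lee_fin.
Qed.

HB.instance Definition _ := isMeasure.Build _ _ _ m m0 m_ge0 m_sigma_additive.

Hypothesis g1 : (\int[mu]_x (g x)%:E = 1)%E.

HB.instance Definition _ := @Measure_isProbability.Build _ _ R m g1.

Lemma probability_of_density : exists nu : probability T R,
  forall A, measurable A -> (nu A = \int[mu]_(x in A) (g x)%:E)%E.
Proof. by exists m. Qed.

End density_measure.

Section change_of_density.
Context (dd : measure_display) (T : measurableType dd) (R : realType).
Variables (mu nu : {measure set T -> \bar R}) (g : T -> R).
Hypothesis (gdens : is_density mu nu g).

Import HBNNSimple.

Let mg : measurable_fun [set: T] g. Proof. by case: gdens. Qed.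
Let g0 x : 0 <= g x. Proof. by case: gdens. Qed.

Let integral_density_indic A : measurable A ->
  (\int[nu]_x (\1_A x)%:E = \int[mu]_x ((\1_A x)%:E * (g x)%:E))%E.
Proof.
move=> mA; rewrite integral_indic// setIT; case: gdens => _ _ ->//.
rewrite integral_mkcond; apply: eq_integral => x _.
by rewrite patchE indicE; case: (x \in A); rewrite /= ?mul1e ?mul0e.
Qed.

Let integral_density_nnsfun (h : {nnsfun T >-> R}) :
  (\int[nu]_x (h x)%:E = \int[mu]_x ((h x)%:E * (g x)%:E))%E.
Proof.
under [LHS]eq_integral do rewrite fimfunE -fsumEFin//.
rewrite [LHS]ge0_integral_fsum//; last 2 first.
  - by move=> r; exact/measurable_EFinP/measurableT_comp.
  - by move=> n x _; rewrite EFinM nnfun_muleindic_ge0.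
under [RHS]eq_integral.
  move=> x xD; rewrite fimfunE -fsumEFin// muleC ge0_mule_fsumr; last first.
    by move=> r; rewrite EFinM nnfun_muleindic_ge0.
  over.
rewrite [RHS]ge0_integral_fsum//; last 2 first.
  - move=> r; apply: emeasurable_funM; first exact/measurable_EFinP.
    by apply/measurable_EFinP/measurableT_comp.
  - move=> n x _; apply: mule_ge0; first by rewrite lee_fin.
    by rewrite EFinM nnfun_muleindic_ge0.
apply: eq_fsbigr => r _; rewrite integralZl_indic_nnsfun//=.
rewrite integral_density_indic//.
have [r0|r0] := leP 0 r.
  rewrite -ge0_integralZl//.
  - by apply: eq_integral => x _; rewrite EFinM [RHS]muleC muleA.
  - by apply: emeasurable_funM; apply/measurable_EFinP.
  - by move=> x _; rewrite mule_ge0 ?lee_fin.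
rewrite preimage_nnfun0//; rewrite !integral0_eq ?mule0//.
  by move=> x _; rewrite indic0 /= ?mulr0 ?mul0e ?mule0.
by move=> x _; rewrite indic0 /= ?mulr0 ?mul0e ?mule0.
Qed.

(** Indicators, then simple functions, then monotone limits. *)
Lemma ge0_integral_density (f : T -> \bar R) : measurable_fun [set: T] f ->
  (forall x, (0 <= f x)%E) ->
  (\int[nu]_x f x = \int[mu]_x (f x * (g x)%:E))%E.
Proof.
move=> mf f0; pose f_ := nnsfun_approx measurableT mf.
have cf x : (f_ n x)%:E @[n --> \oo] --> f x by exact: cvg_nnsfun_approx.
transitivity (limn (fun n => \int[nu]_x (f_ n x)%:E))%E.
  rewrite -monotone_convergence//=.
  - by apply: eq_integral => x _; apply/esym/cvg_lim => //=.
  - by move=> n; exact/measurable_EFinP.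
  - by move=> n x _; rewrite lee_fin.
  - by move=> x _ a b ab; rewrite lee_fin; exact/lefP/nd_nnsfun_approx.
under eq_fun do rewrite integral_density_nnsfun.
rewrite -monotone_convergence//=.
- apply: eq_integral => x _; apply/cvg_lim => //=.
  by under eq_fun do rewrite muleC; rewrite muleC; apply: cvgeZl.
- by move=> n; apply: emeasurable_funM; exact/measurable_EFinP.
- by move=> n x _; rewrite mule_ge0 ?lee_fin.
- move=> x _ a b ab; apply: lee_wpmul2r; first by rewrite lee_fin.
  by rewrite lee_fin; exact/lefP/nd_nnsfun_approx.
Qed.

End change_of_density.

(** A class closed under the operations below and integrable for every probability, so that
    integrability side conditions become structural. *)
Definition bmfun (R : realType) (dd : measure_display) (T : measurableType dd)
    (f : T -> R) : Prop :=
  measurable_fun [set: T] f /\ exists M : R, forall x, `|f x| <= M.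

Section bmfun.
Context (R : realType) (dd : measure_display) (T : measurableType dd).
Implicit Types f g : T -> R.

Lemma bmfun_cst (k : R) : bmfun (fun _ : T => k).
Proof. by split; [exact: measurable_cst|exists `|k|]. Qed.

Lemma bmfunD f g : bmfun f -> bmfun g -> bmfun (fun x => f x + g x).
Proof.
move=> [mf [M fM]] [mg [N gN]]; split; first exact: measurable_funD.
by exists (M + N) => x; apply: (le_trans (ler_normD _ _)); exact: lerD.
Qed.

Lemma bmfunM f g : bmfun f -> bmfun g -> bmfun (fun x => f x * g x).
Proof.
move=> [mf [M fM]] [mg [N gN]]; split; first exact: measurable_funM.
by exists (M * N) => x; rewrite normrM; exact: ler_pM.
Qed.

Lemma bmfunN f : bmfun f -> bmfun (fun x => - f x).
Proof.
move=> [mf [M fM]]; split; first exact: measurableT_comp.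
by exists M => x; rewrite normrN.
Qed.

Lemma bmfunB f g : bmfun f -> bmfun g -> bmfun (fun x => f x - g x).
Proof. by move=> bf bg; apply: bmfunD => //; exact: bmfunN. Qed.

Lemma bmfunZ (k : R) f : bmfun f -> bmfun (fun x => k * f x).
Proof. by move=> bf; apply: bmfunM => //; exact: bmfun_cst. Qed.

Lemma bmfun_expR f : bmfun f -> bmfun (fun x => expR (f x)).
Proof.
move=> [mf [M fM]]; split; first exact: measurableT_comp.
exists (expR M) => x; rewrite ger0_norm ?expR_ge0// ler_expR.
exact: le_trans (ler_norm _) (fM x).
Qed.

Lemma bmfun_integrable (P : probability T R) f : bmfun f ->
  P.-integrable setT (EFin \o f).
Proof.
move=> [mf [M fM]]; apply: measurable_bounded_integrable => //.
  by apply: (@le_lt_trans _ _ 1%E); [exact: probability_le1|exact: ltry].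
exists M; split; first exact: num_real.
by move=> y My x _; exact: le_trans (fM x) (ltW My).
Qed.

Lemma bmfun_integralE (P : probability T R) f : bmfun f ->
  (\int[P]_x (f x)%:E)%E = (\int[P]_x f x)%:E.
Proof.
move=> bf; rewrite /Rintegral fineK//.
by have := integrable_fin_num measurableT (bmfun_integrable P bf).
Qed.

Lemma Rintegral_cst_prob (P : probability T R) (k : R) : \int[P]_x k = k.
Proof.
by rewrite Rintegral_cst// [X in fine X](_ : _ = 1%E) ?mulr1//; exact: probability_setT.
Qed.

End bmfun.

(** * The Gibbs variational inequality *)

Section gibbs.
Context (R : realType) (dd : measure_display) (T : measurableType dd).
Variables (mu nu : probability T R) (g : T -> R).
Hypothesis gdens : is_density mu nu g.

Let mg : measurable_fun [set: T] g. Proof. by case: gdens. Qed.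
Let g0 x : 0 <= g x. Proof. by case: gdens. Qed.

Lemma integral_density1 : (\int[mu]_x (g x)%:E = 1)%E.
Proof. by case: gdens => _ _ <-//; exact: probability_setT. Qed.

Lemma density_integrable : mu.-integrable setT (EFin \o g).
Proof.
apply/integrableP; split; first exact/measurable_EFinP.
under eq_integral do rewrite /= ger0_norm//.
by rewrite integral_density1 ltry.
Qed.

Lemma bmfun_density_integrable f : bmfun f ->
  mu.-integrable setT (EFin \o (fun x => f x * g x)).
Proof.
move=> [mf [M fM]]; apply: (@le_integrable _ _ _ _ _ measurableT _
  (fun x => (M%:E * (EFin \o g) x)%E)).
- by apply/measurable_EFinP; exact: measurable_funM.
- move=> x _; rewrite lee_fin !normrM ler_wpM2r//.
  exact: le_trans (fM x) (ler_norm _).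
- by apply: integrableZl => //; exact: density_integrable.
Qed.

(** Adding the bound [M] reduces to the nonnegative case; the extra [M] cancels since [g] has
    integral 1. *)
Lemma Rintegral_density f : bmfun f ->
  \int[nu]_x f x = \int[mu]_x (f x * g x).
Proof.
move=> /[dup] bf [mf [M fM]].
have e : \int[nu]_x (f x + M) = \int[mu]_x ((f x + M) * g x).
  rewrite /Rintegral (ge0_integral_density gdens)//.
    by apply/measurable_EFinP; apply: measurable_funD.
  by move=> x; rewrite lee_fin; have := fM x; rewrite ler_norml; lra.
have cM := @bmfun_cst R _ T M.
have := e; rewrite RintegralD//; [|exact: bmfun_integrable..].
rewrite Rintegral_cst_prob.
under [RHS]eq_Rintegral do rewrite mulrDl.
rewrite RintegralD//; [|exact: bmfun_density_integrable..].
rewrite RintegralZl//; last exact: density_integrable.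
by rewrite {3}/Rintegral integral_density1/= mulr1 => /addIr.
Qed.

(* the Legendre duality between [g ln g - g] and [exp] *)
Lemma gibbs_young (r s : R) : 0 <= r -> s * r + r - expR s <= r * ln r.
Proof.
rewrite le0r => /orP[/eqP ->|r0].
  by have := expR_gt0 s; rewrite mulr0 mul0r; lra.
have := expR_ge1Dx (s - ln r); rewrite expRD expRN lnK// => h.
have : r * (1 + (s - ln r)) <= r * (expR s / r) by rewrite ler_pM2l.
rewrite mulrCA mulfV ?gt_eqF//; lra.
Qed.

Lemma measurable_entropy : measurable_fun [set: T] (fun x => (g x * ln (g x))%:E).
Proof.
apply/measurable_EFinP/measurable_funM => //.
by apply: measurableT_comp => //; exact: measurable_ln.
Qed.

(** Integrate [gibbs_young] with [s = f x] and [r = g x]: the left side has integral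
    [\int f dnu + 1 - \int e^f dmu]. *)
Lemma gibbs_le f : bmfun f -> \int[mu]_x expR (f x) <= 1 ->
  ((\int[nu]_x f x)%:E <= \int[mu]_x (g x * ln (g x))%:E)%E.
Proof.
move=> bf ef.
pose k x := f x * g x + g x - expR (f x).
have i1 := bmfun_density_integrable bf; have i2 := density_integrable.
have i3 := bmfun_integrable mu (bmfun_expR bf).
have i12 : mu.-integrable setT (EFin \o (fun x => f x * g x + g x)).
  by apply: eq_integrable (integrableD _ i1 i2) => // x _; rewrite /= EFinD.
have ik : mu.-integrable setT (EFin \o k).
  by apply: eq_integrable (integrableB _ i12 i3) => // x _; rewrite /= EFinB.
apply: (@le_trans _ _ (\int[mu]_x (k x)%:E)%E).
  have -> : (\int[mu]_x (k x)%:E = (\int[mu]_x k x)%:E)%E.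
    by rewrite /Rintegral fineK//; have := integrable_fin_num measurableT ik.
  rewrite lee_fin /k RintegralB// RintegralD// -Rintegral_density//.
  by rewrite {3}/Rintegral integral_density1/=; lra.
apply: le_integral_measurable.
- by case/integrableP : ik.
- exact: measurable_entropy.
- by move=> x; rewrite lee_fin; exact: gibbs_young.
Qed.


Lemma entropy_ge0 : (0 <= \int[mu]_x (g x * ln (g x))%:E)%E.
Proof.
have b := bmfun_cst T (0 : R).
have := @gibbs_le (fun=> 0) b; rewrite !Rintegral_cst_prob expR0; exact.
Qed.

End gibbs.

(** * Inf-convolutions and their slope *)

(** The Hopf-Lax transform of [h]. The real [inf] is meaningful for nonempty sets bounded below,
    hence the bound on [h] in the lemmas that follow. *)
Definition infconv (R : realType) (T : Type) (d : T -> T -> R) (lam : R)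
    (h : T -> R) (x : T) : R :=
  inf [set h y + lam * d x y ^+ 2 | y in [set: T]].

Section infconv.
Context (R : realType) (dd : measure_display) (X : measurableType dd).
Variables (d : X -> X -> R) (lam : R).
Hypotheses (dP : is_metric d) (lam0 : 0 <= lam).

Let d_ge0 x y : 0 <= d x y. Proof. by case: dP. Qed.
Let dxx x : d x x = 0. Proof. by case: dP => _ h _ _; apply/h. Qed.
Let dC x y : d x y = d y x. Proof. by case: dP. Qed.
Let dtri x y z : d x z <= d x y + d y z. Proof. by case: dP. Qed.

Section bounded.
Variables (h : X -> R) (M : R).
Hypothesis hM : forall x, `|h x| <= M.

Let has_inf_h x : has_inf [set h y + lam * d x y ^+ 2 | y in [set: X]].
Proof.
split; first by exists (h x + lam * d x x ^+ 2), x.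
exists (- M) => _ [y _ <-]; have := hM y; rewrite ler_norml => /andP[h1 _].
by have : 0 <= lam * d x y ^+ 2 by [rewrite mulr_ge0// sqr_ge0]; lra.
Qed.

Lemma infconv_le x y : infconv d lam h x <= h y + lam * d x y ^+ 2.
Proof. by apply: ge_inf; [case: (has_inf_h x)|exists y]. Qed.

Lemma infconv_ge x (c : R) :
  (forall y, c <= h y + lam * d x y ^+ 2) -> c <= infconv d lam h x.
Proof. by move=> H; apply: lb_le_inf; [case: (has_inf_h x)|move=> _ [y _ <-]]. Qed.

Lemma infconv_adherent x (e : R) : 0 < e ->
  exists y, h y + lam * d x y ^+ 2 < infconv d lam h x + e.
Proof.
by move=> e0; have [_ [y _ <-] ?] := inf_adherent e0 (has_inf_h x); exists y.
Qed.

Lemma infconv_bounded x : `|infconv d lam h x| <= M.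
Proof.
rewrite ler_norml; apply/andP; split.
  apply: infconv_ge => y; have := hM y; rewrite ler_norml => /andP[h1 _].
  by have : 0 <= lam * d x y ^+ 2 by [rewrite mulr_ge0// sqr_ge0]; lra.
apply: (le_trans (infconv_le x x)); rewrite dxx expr0n/= mulr0 addr0.
by have := hM x; rewrite ler_norml => /andP[].
Qed.

(** Links the real infimum with the extended one in [inF]; the shift [c] accommodates the
    normalising constant of the density. *)
Lemma infconv_ereal x (c : R) : ((infconv d lam h x + c)%:E =
  ereal_inf [set (h y + c + lam * d x y ^+ 2)%:E | y in [set: X]])%E.
Proof.
apply/eqP; rewrite eq_le; apply/andP; split.
  apply: le_ereal_inf_tmp => _ [y _ <-]; rewrite lee_fin.
  by have := infconv_le x y; lra.
apply/lee_addgt0Pr => e e0; have [y ye] := infconv_adherent x e0.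
apply: (@le_trans _ _ (h y + c + lam * d x y ^+ 2)%:E).
  by apply: ereal_inf_lbound; exists y.
by rewrite -EFinD lee_fin; lra.
Qed.

(* an infimum of continuous functions is upper semicontinuous *)
Lemma dopen_infconv (a : R) : dopen d [set x | infconv d lam h x < a].
Proof.
move=> x /= xa.
have ax : 0 < a - infconv d lam h x by rewrite subr_gt0.
have [y ye] := infconv_adherent x ax.
pose e := a - (h y + lam * d x y ^+ 2).
have e0 : 0 < e by rewrite /e; lra.
(* For [d x z < 1], [d z y ^+ 2] exceeds [d x y ^+ 2] by at most [d x z * (2 * d x y + 1)]; the
   final 1 makes [K] positive. *)
pose K := lam * (2 * d x y + 1) + 1.
have K0 : 0 < K by rewrite /K ltr_wpDl// mulr_ge0// addr_ge0// mulr_ge0.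
exists (Num.min 1 (e / K)); split.
  by rewrite lt_min ltr01 divr_gt0.
move=> z; rewrite lt_min => /andP[z1]; rewrite ltr_pdivlMr// => z2 /=.
apply: (le_lt_trans (infconv_le z y)).
have t : d z y <= d x z + d x y by rewrite (dC x z); exact: dtri.
have t2 : d z y ^+ 2 <= (d x z + d x y) ^+ 2 by rewrite lerXn2r ?nnegrE ?addr_ge0.
have zx := d_ge0 x z; have xy := d_ge0 x y.
have t3 : d z y ^+ 2 <= d x y ^+ 2 + d x z * (2 * d x y + 1) by nra.
have := ler_wpM2l lam0 t3; move: z2; rewrite /K /e; nra.
Qed.

End bounded.

(** The same near-minimiser [y] is tested in both [f x] and [f' x]; eliminating [h y] leaves a bound
    on [lam * d x y ^+ 2]. Keeping [y] while moving [x] to [z] changes the cost by about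
    [2 * lam * d x y * d z x], which controls the slope. *)
Lemma slope_infconv_le (h : X -> R) (M c k k' : R) (x : X) :
  (forall x, `|h x| <= M) -> 0 < k -> k < k' ->
  let f := infconv d lam (fun y => k * h y) in
  let f' := infconv d lam (fun y => k' * h y) in
  ((slope d (fun z => f z - c)%R x) ^+ 2 <=
   (4 * lam * ((k' * f x - k * f' x) / (k' - k)))%:E)%E /\
  0 <= (k' * f x - k * f' x) / (k' - k).
Proof.
move=> hM k0 kk' f f'.
have kM y : `|k * h y| <= k * M by rewrite normrM gtr0_norm// ler_pM2l.
have k'0 : 0 < k' by exact: lt_trans kk'.
have k'M y : `|k' * h y| <= k' * M by rewrite normrM gtr0_norm// ler_pM2l.
have dk : 0 < k' - k by rewrite subr_gt0.
set S := _ / _.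
pose kap := k' / (k' - k).
have kap0 : 0 < kap by rewrite divr_gt0.
have near (e : R) : 0 < e -> exists y, k * h y + lam * d x y ^+ 2 < f x + e /\
    lam * d x y ^+ 2 <= S + kap * e.
  move=> e0; have [y ye] := infconv_adherent kM x e0; exists y; split=> //.
  have y' := infconv_le k'M x y.
  rewrite /S /kap mulrAC -mulrDl ler_pdivlMr//.
  have p1 : k * f' x <= k * (k' * h y + lam * d x y ^+ 2) by rewrite ler_pM2l.
  have p2 : k' * (k * h y + lam * d x y ^+ 2) <= k' * (f x + e).
    by rewrite ler_pM2l// ltW.
  nra.
have S0 : 0 <= S.
  apply/ler_addgt0Pr => e e0; have [|y [_ y2]] := near (e / kap); first by rewrite divr_gt0.
  move: y2; rewrite [kap * _]mulrC divfK ?gt_eqF//; apply: le_trans.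
  by rewrite mulr_ge0// sqr_ge0.
split=> //.
have slope0 : (0 <= slope d (fun z => f z - c)%R x)%E.
  apply: le_ereal_inf_tmp => _ [r _ <-].
  by apply: ereal_sup_ubound; left.
(* [A] is the bound sought for the slope, and [K * r] dominates the error on the punctured ball of
   radius [r]. *)
pose A : R := 2 * Num.sqrt (lam * S).
pose K : R := 2 * Num.sqrt (lam * kap) + lam + 1.
have K0 : 0 < K by rewrite /K ltr_wpDl// addr_ge0// mulr_ge0// sqrtr_ge0.
have A0 : 0 <= A by rewrite mulr_ge0// sqrtr_ge0.
have slopeA : (slope d (fun z => f z - c)%R x <= A%:E)%E.
  apply/lee_addgt0Pr => e e0; pose r : R := e / K.
  have r0 : 0 < r by rewrite divr_gt0.
  apply: (@le_trans _ _ (A + K * r)%:E); last first.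
    by rewrite -EFinD lee_fin /r mulrC divfK ?gt_eqF.
  apply: ereal_inf_le; eexists; first by exists r; [exact: r0|reflexivity].
  apply: ge_ereal_sup => _ [->|[z /andP[zx zr] <-]].
    by rewrite lee_fin; apply: addr_ge0 => //; apply: mulr_ge0; exact: ltW.
  rewrite lee_fin ler_pdivrMr// ge_max; apply/andP; split; last first.
    by apply: mulr_ge0 => //; apply: addr_ge0 => //; apply: mulr_ge0; exact: ltW.
  (* A minimiser may not exist. The tolerance [d z x ^+ 2] remains negligible after division by
     [d z x]. *)
  have [|y [y1 y2]] := near (d z x ^+ 2); first by rewrite exprn_gt0.
  have zy := infconv_le kM z y; rewrite -/f in zy.
  have t : d z y <= d z x + d x y by exact: dtri.
  have t2 : d z y ^+ 2 <= (d z x + d x y) ^+ 2 by rewrite lerXn2r ?nnegrE ?addr_ge0.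
  have t3 := ler_wpM2l lam0 t2.
  have t4 : f z - c - (f x - c) <= d z x * (2 * (lam * d x y) + lam * d z x + d z x).
    by move: t3; nra.
  apply: (le_trans t4); rewrite mulrC ler_wpM2r//.
  have sqrt_lam : lam * d x y <= Num.sqrt (lam * S) + Num.sqrt (lam * kap) * r.
    set s1 := Num.sqrt _; set s2 := Num.sqrt _.
    have s10 : 0 <= s1 by exact: sqrtr_ge0.
    have s20 : 0 <= s2 by exact: sqrtr_ge0.
    have e1 : s1 ^+ 2 = lam * S by rewrite sqr_sqrtr// mulr_ge0.
    have e2 : s2 ^+ 2 = lam * kap by rewrite sqr_sqrtr// mulr_ge0// ltW.
    have s2r : 0 <= s2 * r by rewrite mulr_ge0// ltW.
    rewrite -(@ler_pXn2r _ 2)// ?nnegrE; [|exact: mulr_ge0|exact: addr_ge0].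
    have q1 : (lam * d x y) ^+ 2 <= lam * (S + kap * d z x ^+ 2).
      by rewrite exprMn expr2 -mulrA ler_wpM2l.
    have q2 : lam * kap * d z x ^+ 2 <= lam * kap * r ^+ 2.
      apply: ler_wpM2l; first by apply: mulr_ge0 => //; exact: ltW.
      by apply: lerXn2r; rewrite ?nnegrE//; exact: ltW.
    have q3 : 0 <= s1 * (s2 * r) by rewrite mulr_ge0.
    rewrite sqrrD [(s2 * r) ^+ 2]exprMn e1 e2; move: q1; rewrite mulrDr mulrA => q1; lra.
  have : lam * d z x <= lam * r by rewrite ler_wpM2l// ltW.
  rewrite /A /K; move: zr sqrt_lam; nra.
have -> : (4 * lam * S)%:E = (A%:E ^+ 2)%E.
  rewrite -EFin_expe; congr (_%:E).
  by rewrite /A exprMn sqr_sqrtr; [ring|exact: mulr_ge0].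
by rewrite !expe2 lee_pmul.
Qed.

End infconv.

(** * From the restricted log-Sobolev inequality to an exponential bound *)

Lemma measurable_fun_lt_sets (R : realType) (dd : measure_display)
    (T : measurableType dd) (f : T -> R) :
  (forall a : R, measurable [set x | f x < a]) -> measurable_fun [set: T] f.
Proof.
move=> mf mT; apply: (measurability _ (RGenInftyO.measurableE R)) => //.
move=> _ [_ [a ->] <-]; rewrite setTI.
have -> : f @^-1` `]-oo, a[ = [set x | f x < a].
  by apply/seteqP; split => x /=; rewrite in_itv.
exact: mf.
Qed.

Lemma dopen_measurable (R : realType) (dd : measure_display)
    (X : measurableType dd) (d : X -> X -> R) (A : set X) :
  polish_borel d -> dopen d A -> measurable A.
Proof. by move=> [_ _ _ mE] oA; apply/mE; exact: sub_sigma_algebra. Qed.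

Lemma infconv_bmfun (R : realType) (dd : measure_display) (X : measurableType dd)
    (d : X -> X -> R) (lam : R) (h : X -> R) :
  polish_borel d -> 0 <= lam -> (exists M, forall x, `|h x| <= M) ->
  bmfun (infconv d lam h).
Proof.
move=> /[dup] pd [dP _ _ _] lam0 [M hM]; split; last first.
  by exists M => x; exact: infconv_bounded.
apply: measurable_fun_lt_sets => a; apply: (dopen_measurable pd).
exact: (dopen_infconv dP lam0 hM).
Qed.

Section quasi_monotone.
Context (R : realType).
Variables (L : R -> R) (M c : R).
Hypothesis M0 : 0 <= M.
Hypothesis step : forall k k', 0 < k -> k < k' -> (k' - k) * M <= 1/2 ->
  L k' / k' <= L k / k + 2 * M ^+ 2 * (k' - k) ^+ 2 / k'.
Hypothesis init : forall a, 0 < a -> a * M <= 1/2 -> L a / a <= c + 2 * M ^+ 2 * a.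

(** All points of the subdivision are at least [a], so each step costs at most the quadratic error
    divided by [a]. *)
Let iter_step (a de : R) (n : nat) : 0 < a -> 0 < de -> de * M <= 1/2 ->
  L (a + n%:R * de) / (a + n%:R * de) <= L a / a + n%:R * (2 * M ^+ 2 * de ^+ 2 / a).
Proof.
move=> a0 de0 small; elim: n => [|n IH]; first by rewrite !mul0r !addr0.
set k := a + n%:R * de in IH.
have nde : 0 <= n%:R * de by rewrite mulr_ge0// ltW.
have k0 : 0 < k by rewrite ltr_wpDr.
have -> : a + n.+1%:R * de = k + de by rewrite -natr1 mulrDl mul1r addrA.
have kde : k < k + de by rewrite ltrDl.
have := step k0 kde; rewrite [k + de - k]addrC addKr => /(_ small) h1.
apply: (le_trans h1).
have -> : n.+1%:R * (2 * M ^+ 2 * de ^+ 2 / a) =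
    n%:R * (2 * M ^+ 2 * de ^+ 2 / a) + 2 * M ^+ 2 * de ^+ 2 / a.
  by rewrite -[n.+1%:R]natr1 mulrDl mul1r.
rewrite [leRHS]addrA; apply: lerD => //.
apply: ler_wpM2l; first by rewrite mulr_ge0 ?sqr_ge0// mulr_ge0 ?sqr_ge0.
have ak : a <= k + de by rewrite /k -addrA lerDl addr_ge0// ltW.
by rewrite lef_pV2 ?posrE//; exact: lt_le_trans ak.
Qed.

(** With [n] equal steps from [a] to 1 the accumulated error is of order [1 / n]. *)
Let le_small a : 0 < a -> a < 1 -> L 1 <= L a / a.
Proof.
move=> a0 a1; apply/ler_addgt0Pr => e e0.
(* The first summand makes the mesh admissible for [step], the second makes the total error at most
   [e]. *)
pose K := 2 * M + 2 * M ^+ 2 / a / e + 1.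
have M2 : 0 <= 2 * M ^+ 2 by rewrite mulr_ge0 ?sqr_ge0.
have q1 : 0 <= 2 * M ^+ 2 / a by rewrite divr_ge0// ltW.
have q0 : 0 <= 2 * M ^+ 2 / a / e by rewrite divr_ge0// ltW.
have K0 : 0 <= K by rewrite /K; move: q0 M0; lra.
pose n := (Num.truncn K).+1.
have Kn : K < n%:R by rewrite /n; have := truncnS_gt K.
have n0 : 0 < n%:R :> R by exact: le_lt_trans Kn.
pose de := (1 - a) / n%:R.
have de0 : 0 < de by rewrite divr_gt0// subr_gt0.
have small : de * M <= 1/2.
  by rewrite /de mulrAC ler_pdivrMr//; move: Kn; rewrite /K; nra.
have := iter_step n a0 de0 small.
have -> : a + n%:R * de = 1 by rewrite /de mulrC divfK ?gt_eqF//; lra.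
rewrite divr1 => h1; apply: (le_trans h1); rewrite lerD2l.
have -> : n%:R * (2 * M ^+ 2 * de ^+ 2 / a) = (2 * M ^+ 2 / a) * (1 - a) ^+ 2 / n%:R.
  by rewrite /de; field; rewrite !gt_eqF.
rewrite ler_pdivrMr//.
have K1 : 2 * M ^+ 2 / a <= e * n%:R.
  have : 2 * M ^+ 2 / a / e <= n%:R.
    apply: le_trans (ltW Kn); rewrite /K -addrA addrCA lerDl.
    by rewrite addr_ge0// mulr_ge0.
  by rewrite (ler_pdivrMr _ _ e0) (mulrC e).
apply: le_trans K1; rewrite ler_piMr// expr_le1//; lra.
Qed.

(* A subdivision of mesh [delta] costs only [O(delta)]: this replaces the
   differential inequality [(L k / k)' <= 0]. *)
Lemma quasi_monotone_le : L 1 <= c.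
Proof.
apply/ler_addgt0Pr => e e0.
(* The starting point is [K^-1]: the summands give in turn [K^-1 * M <= 1/2], an initial error at
   most [e], and [K^-1 < 1]. *)
pose K := 2 * M + 2 * M ^+ 2 / e + 2.
have M2 : 0 <= 2 * M ^+ 2 by rewrite mulr_ge0 ?sqr_ge0.
have q0 : 0 <= 2 * M ^+ 2 / e by rewrite divr_ge0// ltW.
have K0 : 0 < K by rewrite /K; move: q0 M0; lra.
have a0 : 0 < K^-1 by rewrite invr_gt0.
have K1 : 1 < K by rewrite /K; move: q0 M0; lra.
have K2 : 2 * M <= K by rewrite /K; move: q0 M0; lra.
have a1 : K^-1 < 1 by rewrite invf_lt1.
apply: (le_trans (le_small a0 a1)).
have small : K^-1 * M <= 1/2 by rewrite mulrC ler_pdivrMr//; move: K2; lra.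
apply: (le_trans (init a0 small)); rewrite lerD2l ler_pdivrMr//.
have : 2 * M ^+ 2 / e <= K by rewrite /K; move: q0 M0; lra.
by rewrite (ler_pdivrMr _ _ e0) (mulrC e).
Qed.

End quasi_monotone.

Section exponential_bound.
Context (R : realType) (dd : measure_display) (X : measurableType dd).
Variables (d : X -> X -> R) (mu : probability X R) (lam0 D lam : R).
Hypotheses (pd : polish_borel d) (D0 : 0 < D).
Hypotheses (lam_gt0 : 0 < lam) (lam_lt : lam < lam0) (lamD : 4 * D * lam <= 1).
Hypothesis lsi : forall (nu : probability X R) (f : X -> R), inF d lam0 f ->
  (forall A, measurable A -> (nu A = \int[mu]_(x in A) (expR (f x))%:E)%E) ->
  (relent mu nu <= D%:E * fisher d mu f)%E.
Variables (h : X -> R) (M : R).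
Hypotheses (mh : measurable_fun [set: X] h) (hM : forall x, `|h x| <= M).

Let dP : is_metric d. Proof. by case: pd. Qed.
Let lam_ge0 : 0 <= lam. Proof. exact: ltW. Qed.
Let bh : bmfun h. Proof. by split=> //; exists M. Qed.

Let f (k : R) := infconv d lam (fun y => k * h y).

Let khM (k : R) x : `|k * h x| <= `|k| * M.
Proof. by rewrite normrM ler_wpM2l. Qed.

Let bf k : bmfun (f k).
Proof. by apply: infconv_bmfun => //; exists (`|k| * M) => x; exact: khM. Qed.

Let Z (k : R) : R := \int[mu]_x expR (f k x).

Let Z_gt0 k : 0 < Z k.
Proof.
apply: (@lt_le_trans _ _ (expR (- (`|k| * M)))); first exact: expR_gt0.
rewrite -[leLHS](Rintegral_cst_prob mu); apply: le_Rintegral => //.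
- exact: bmfun_integrable (bmfun_cst _ _).
- exact: bmfun_integrable (bmfun_expR _).
- move=> x _; rewrite ler_expR.
  by have := infconv_bounded dP lam_ge0 (khM k) x; rewrite ler_norml => /andP[].
Qed.

Let L k := ln (Z k).

Let expRL k : expR (L k) = Z k. Proof. by rewrite lnK// posrE. Qed.

Let phi k x := f k x - L k.

Let bphi k : bmfun (phi k).
Proof. by apply: bmfunB => //; exact: bmfun_cst. Qed.

Let bexpphi k : bmfun (fun x => expR (phi k x)).
Proof. exact: bmfun_expR. Qed.

Let int_expphi k : \int[mu]_x expR (phi k x) = 1.
Proof.
under eq_Rintegral do rewrite /phi expRB.
rewrite RintegralZr//; last exact: bmfun_integrable (bmfun_expR _).
by rewrite expRL; exact/mulfV/lt0r_neq0/Z_gt0.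
Qed.

Let f_lip k k' x : k <= k' -> `|f k' x - f k x| <= (k' - k) * M.
Proof.
move=> kk'.
have b y : `|(k' - k) * h y| <= (k' - k) * M.
  by rewrite normrM ger0_norm ?subr_ge0// ler_wpM2l// subr_ge0.
have h1 : f k x - (k' - k) * M <= f k' x.
  refine (infconv_ge lam_ge0 (khM k') _) => y.
  have := infconv_le d lam_ge0 (khM k) x y; rewrite -/(f k).
  have := b y; rewrite ler_norml => /andP[]; lra.
have h2 : f k' x - (k' - k) * M <= f k x.
  refine (infconv_ge lam_ge0 (khM k) _) => y.
  have := infconv_le d lam_ge0 (khM k') x y; rewrite -/(f k').
  have := b y; rewrite ler_norml => /andP[]; lra.
by rewrite ler_norml; apply/andP; split; lra.
Qed.

(** The log-Sobolev hypothesis applied to [e^(phi k) mu]. As [4 * D * lam <= 1], it gives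
    [\int phi e^phi <= \int S e^phi]; both sides are affine in the integrals [a] and [b] of [f k]
    and [f k'] against [e^phi], and the claim is a rearrangement. *)
Let lsi_step k k' : 0 < k -> k < k' ->
  k * (\int[mu]_x ((f k' x - f k x) * expR (phi k x))) <= (k' - k) * L k.
Proof.
move=> k0 kk'; have dk : 0 < k' - k by rewrite subr_gt0.
have iexp : (\int[mu]_x (expR (phi k x))%:E = 1)%E.
  by rewrite bmfun_integralE// int_expphi.
have [mexp _] := bexpphi k.
have [nu nuE] := probability_of_density mexp (fun x => expR_ge0 (phi k x)) iexp.
have dens : is_density mu nu (fun x => expR (phi k x)).
  by split=> // x; exact: expR_ge0.
have phiF : inF d lam0 (phi k).
  (* The definition of [inF] carries [- g], hence the reversed signs. *)
  exists (fun y => - (k * h y) + L k), lam; split; first by rewrite lam_gt0 lam_lt.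
  move=> x; rewrite /phi (infconv_ereal d lam_ge0 (khM k)); congr ereal_inf.
  by apply: eq_imagel => y _; congr (_%:E); lra.
pose S x := (k' * f k x - k * f k' x) / (k' - k).
have bS : bmfun S.
  by apply: bmfunM; [apply: bmfunB; exact: bmfunZ|exact: bmfun_cst].
have sl x := slope_infconv_le dP lam_ge0 (L k) x hM k0 kk'.
have S0 x : 0 <= S x by case: (sl x).
have bSe : bmfun (fun x => S x * expR (phi k x)) by exact: bmfunM.
(* [relent] is an infimum over densities; the Gibbs inequality tested on [phi k] itself bounds each
   of them from below. *)
have ent : ((\int[mu]_x (phi k x * expR (phi k x)))%:E <= relent mu nu)%E.
  apply: le_ereal_inf_tmp => _ [g gd <-].
  rewrite -(Rintegral_density dens)//; apply: (gibbs_le gd) => //.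
  by rewrite int_expphi.
have fis : (fisher d mu (phi k) <=
    (4 * lam * \int[mu]_x (S x * expR (phi k x)))%:E)%E.
  rewrite -RintegralZl//; last exact: bmfun_integrable.
  rewrite -bmfun_integralE; last exact: bmfunZ.
  apply: ge0_le_lower_integral => x.
    by rewrite mule_ge0 ?lee_fin ?expR_ge0// expe2 sqre_ge0.
  have [s1 _] := sl x; rewrite mulrA EFinM; apply: lee_wpmul2r => //.
have := le_trans ent (le_trans (lsi phiF nuE) (lee_wpmul2l _ fis)).
rewrite lee_fin => /(_ (ltW D0)); rewrite -EFinM lee_fin => main.
have {}main : \int[mu]_x (phi k x * expR (phi k x)) <=
    \int[mu]_x (S x * expR (phi k x)).
  apply: (le_trans main); rewrite !mulrA -[leRHS]mul1r; apply: ler_wpM2r.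
    by apply: Rintegral_ge0 => x _; rewrite mulr_ge0// expR_ge0.
  by rewrite (mulrC D).
have ia : mu.-integrable setT (EFin \o (fun x => f k x * expR (phi k x))).
  by apply: bmfun_integrable; exact: bmfunM.
have ib : mu.-integrable setT (EFin \o (fun x => f k' x * expR (phi k x))).
  by apply: bmfun_integrable; exact: bmfunM.
have ie := bmfun_integrable mu (bexpphi k).
set a := \int[mu]_x (f k x * expR (phi k x)) in main *.
set b := \int[mu]_x (f k' x * expR (phi k x)) in main *.
have E1 : \int[mu]_x (phi k x * expR (phi k x)) = a - L k.
  under eq_Rintegral do rewrite {1}/phi mulrBl.
  rewrite RintegralB//; last by apply: bmfun_integrable; exact: bmfunZ.
  by rewrite RintegralZl// int_expphi mulr1.
have E2 : \int[mu]_x (S x * expR (phi k x)) = (k' * a - k * b) / (k' - k).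
  transitivity (\int[mu]_x ((k' / (k' - k)) * (f k x * expR (phi k x)) -
                            (k / (k' - k)) * (f k' x * expR (phi k x)))).
    by apply: eq_Rintegral => x _; rewrite /S; field; rewrite gt_eqF.
  rewrite RintegralB//; last 2 first.
  - by apply: bmfun_integrable; apply: bmfunZ; exact: bmfunM.
  - by apply: bmfun_integrable; apply: bmfunZ; exact: bmfunM.
  by rewrite !RintegralZl// -/a -/b; field; rewrite gt_eqF.
have E3 : \int[mu]_x ((f k' x - f k x) * expR (phi k x)) = b - a.
  under eq_Rintegral do rewrite mulrBl.
  by rewrite RintegralB.
by move: main; rewrite E1 E2 E3 ler_pdivlMr//; nra.
Qed.

(** [Z k' / Z k] is the mean of [e^(f k' - f k)] under the tilted measure. Its second order
    expansion has linear term at most [(k' - k) * L k / k] by [lsi_step], so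
    [L k' <= (k' / k) * L k] up to the quadratic error. *)
Let L_step k k' : 0 < k -> k < k' -> (k' - k) * M <= 1/2 ->
  L k' / k' <= L k / k + 2 * M ^+ 2 * (k' - k) ^+ 2 / k'.
Proof.
move=> k0 kk' small; have k'0 : 0 < k' by exact: lt_trans kk'.
have dk : 0 < k' - k by rewrite subr_gt0.
pose de x := f k' x - f k x.
have bde : bmfun de by exact: bmfunB.
have deM x : `|de x| <= (k' - k) * M by exact/f_lip/ltW.
pose t := \int[mu]_x (de x * expR (phi k x)) + 2 * M ^+ 2 * (k' - k) ^+ 2.
have bde1 : bmfun (fun x => expR (de x) * expR (phi k x)).
  by apply: bmfunM => //; exact: bmfun_expR.
have bde2 : bmfun (fun x => de x * expR (phi k x)) by exact: bmfunM.
have ZE : Z k' = Z k * \int[mu]_x (expR (de x) * expR (phi k x)).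
  rewrite -RintegralZl//; last exact: bmfun_integrable.
  apply: eq_Rintegral => x _; rewrite /phi /de -expRD.
  have -> : f k' x - f k x + (f k x - L k) = f k' x - L k by lra.
  by rewrite expRB expRL mulrC divfK// gt_eqF.
have le1 : \int[mu]_x (expR (de x) * expR (phi k x)) <= 1 + t.
  pose c := 1 + 2 * M ^+ 2 * (k' - k) ^+ 2.
  have -> : 1 + t = \int[mu]_x (de x * expR (phi k x) + c * expR (phi k x)).
    rewrite RintegralD//; [|exact: bmfun_integrable|].
      rewrite RintegralZl//; last exact: bmfun_integrable.
      by rewrite int_expphi mulr1 /t /c addrCA.
    by apply: bmfun_integrable; exact: bmfunZ.
  apply: le_Rintegral => //; first exact: bmfun_integrable.
    by apply: bmfun_integrable; apply: bmfunD => //; exact: bmfunZ.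
  move=> x _; rewrite -mulrDl ler_wpM2r ?expR_ge0//.
  have dx := deM x.
  apply: (@le_trans _ _ (1 + de x + 2 * de x ^+ 2)).
    by apply: expR_le_quadratic; apply: le_trans small; exact: le_trans (ler_norm _) dx.
  have : de x ^+ 2 <= ((k' - k) * M) ^+ 2.
    by rewrite -(real_normK (num_real (de x))) lerXn2r ?nnegrE//; exact: le_trans dx.
  rewrite exprMn => h2; rewrite /c [leRHS]addrCA addrA lerD2l -mulrA ler_pM2l//.
  by rewrite mulrC.
have LE : L k' <= L k + t.
  have ln_le (l l' z z' : R) : expR l = z -> expR l' = z' ->
      z' <= z * expR t -> l' <= l + t.
    by move=> <- <-; rewrite -expRD ler_expR.
  refine (ln_le _ _ _ _ (expRL k) (expRL k') _); rewrite ZE.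
  by apply: ler_wpM2l; [exact: ltW|exact: le_trans le1 (expR_ge1Dx t)].
have st := lsi_step k0 kk'; rewrite -/(de) in st.
rewrite ler_pdivrMr// mulrDl [X in _ <= _ + X]divfK ?gt_eqF//.
have st' : \int[mu]_x (de x * expR (phi k x)) <= (k' - k) * L k / k.
  by rewrite ler_pdivlMr// mulrC.
apply: (le_trans LE); rewrite /t addrA lerD2r.
apply: (le_trans (lerD (lexx (L k)) st')).
by rewrite le_eqVlt; apply/orP; left; apply/eqP; field; rewrite gt_eqF.
Qed.

Let M_ge0 : 0 <= M.
Proof.
have [x _] : [set: X] !=set0.
  apply/set0P/eqP => e; have := probability_setT mu; rewrite e measure0 => /eqP.
  by rewrite eq_sym onee_eq0.
exact: le_trans (hM x).
Qed.

(** Taking [y = x] gives [f a <= a h]; then [e^(a h)] is expanded to second order and [1 + t <= e^t]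
    is used. *)
Let L_init a : 0 < a -> a * M <= 1/2 -> L a / a <= \int[mu]_x h x + 2 * M ^+ 2 * a.
Proof.
move=> a0 small; rewrite ler_pdivrMr//.
set t := _ * a; rewrite -ler_expR expRL.
apply: le_trans (expR_ge1Dx t).
have -> : 1 + t = \int[mu]_x (a * h x + (1 + 2 * M ^+ 2 * a ^+ 2)).
  rewrite RintegralD//; first last.
  - exact: bmfun_integrable (bmfun_cst _ _).
  - by apply: bmfun_integrable; exact: bmfunZ.
  rewrite Rintegral_cst_prob RintegralZl//; last exact: bmfun_integrable.
  by rewrite /t; lra.
apply: le_Rintegral => //; first exact: bmfun_integrable (bmfun_expR _).
  by apply: bmfun_integrable; apply: bmfunD; [exact: bmfunZ|exact: bmfun_cst].
move=> x _; have [_ dxx _ _] := dP.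
have fh : f a x <= a * h x.
  have := infconv_le d lam_ge0 (khM a) x x.
  by rewrite (dxx x x).2// expr0n/= mulr0 addr0.
apply: (@le_trans _ _ (expR (a * h x))); first by rewrite ler_expR.
have ah : `|a * h x| <= a * M by rewrite normrM gtr0_norm// ler_pM2l.
apply: (@le_trans _ _ (1 + a * h x + 2 * (a * h x) ^+ 2)).
  by apply: expR_le_quadratic; apply: le_trans small; exact: le_trans (ler_norm _) ah.
have : (a * h x) ^+ 2 <= (a * M) ^+ 2.
  by rewrite -(real_normK (num_real (a * h x))) lerXn2r ?nnegrE//; exact: le_trans ah.
by rewrite (exprMn _ a M); lra.
Qed.

Lemma exp_infconv_le : \int[mu]_x expR (infconv d lam h x) <= expR (\int[mu]_x h x).
Proof.
have -> : infconv d lam h = f 1.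
  by congr infconv; apply/funext => x; rewrite mul1r.
rewrite -/(Z 1) -expRL ler_expR.
by apply: (quasi_monotone_le M_ge0 L_step L_init).
Qed.

End exponential_bound.

(** * Second moments *)

Lemma measurable_dist (R : realType) (dd : measure_display) (X : measurableType dd)
    (d : X -> X -> R) (y : X) :
  polish_borel d -> measurable_fun [set: X] (fun x => d x y).
Proof.
move=> pd; have [[_ _ dC dtri] _ _ _] := pd.
apply: measurable_fun_lt_sets => a; apply: (dopen_measurable pd) => x /= xa.
exists (a - d x y); split; first by rewrite subr_gt0.
by move=> z xz; have := dtri z x y; rewrite (dC z x); lra.
Qed.

Lemma integrable_of_truncations (R : realType) (dd : measure_display)
    (T : measurableType dd) (P : probability T R) (f : T -> R) (K : R) :
  measurable_fun [set: T] f -> (forall x, 0 <= f x) ->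
  (forall n : nat, \int[P]_x Num.min (f x) n%:R <= K) ->
  P.-integrable setT (EFin \o f).
Proof.
move=> mf f0 fK.
have bm n : bmfun (fun x => Num.min (f x) n%:R).
  split; first exact: measurable_minr.
  exists n%:R => x; rewrite ger0_norm ?le_min ?f0 ?ler0n// ge_min.
  by rewrite lexx orbT.
apply/integrableP; split; first exact/measurable_EFinP.
under eq_integral do rewrite /= ger0_norm//.
rewrite (_ : (fun x => (f x)%:E) =
    (fun x => limn (fun n => (Num.min (f x) n%:R)%:E))); last first.
  apply/funext => x; apply/esym/cvg_lim => //; apply: cvg_near_cst.
  exists (Num.truncn (f x)).+1 => // n /= n1; congr (_%:E); apply/min_idPl.
  have := truncnS_gt (f x) => /ltW/le_trans; apply.
  by rewrite ler_nat.
rewrite monotone_convergence//.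
- apply: (@le_lt_trans _ _ K%:E); last exact: ltry.
  apply: lime_le.
    apply: ereal_nondecreasing_is_cvgn => a b ab; rewrite !bmfun_integralE// lee_fin.
    apply: le_Rintegral => //; [exact: bmfun_integrable..|].
    move=> x _; rewrite le_min ge_min lexx/= ge_min.
    by apply/orP; right; rewrite ler_nat.
  by apply: nearW => n; rewrite bmfun_integralE// lee_fin.
- by move=> n; apply/measurable_EFinP; case: (bm n).
- by move=> n x _; rewrite lee_fin le_min f0 ler0n.
- move=> x _ a b ab; rewrite lee_fin le_min ge_min lexx/= ge_min.
  by apply/orP; right; rewrite ler_nat.
Qed.

Section moments.
Context (R : realType) (dd : measure_display) (X : measurableType dd).
Variables (d : X -> X -> R) (mu : probability X R) (lam : R).
Hypotheses (pd : polish_borel d) (lam_gt0 : 0 < lam).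
Hypothesis exp_le : forall h : X -> R, bmfun h ->
  \int[mu]_x expR (infconv d lam h x) <= expR (\int[mu]_x h x).

Let dP : is_metric d. Proof. by case: pd. Qed.
Let lam_ge0 : 0 <= lam. Proof. exact: ltW. Qed.
Let d_ge0 x y : 0 <= d x y. Proof. by case: dP. Qed.
Let dC x y : d x y = d y x. Proof. by case: dP. Qed.
Let dtri x y z : d x z <= d x y + d y z. Proof. by case: dP. Qed.

(** The constraint says that [phi] lies below [infconv d lam h], and [exp_le] makes
    [infconv d lam h - \int h dmu] admissible in the Gibbs inequality. *)
Lemma dual_bound (nu : probability X R) (g : X -> R) (phi h : X -> R) :
  is_density mu nu g -> nu.-integrable setT (EFin \o phi) -> bmfun h ->
  (forall x y, phi x <= h y + lam * d x y ^+ 2) ->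
  ((\int[nu]_x phi x - \int[mu]_x h x)%:E <= \int[mu]_x (g x * ln (g x))%:E)%E.
Proof.
move=> gd iphi bh phih; have [_ hM] := bh.
have bi : bmfun (infconv d lam h) by exact: infconv_bmfun.
set m := \int[mu]_x h x.
have := @gibbs_le _ _ _ mu nu g gd (fun x => infconv d lam h x - m).
move=> /(_ (bmfunB bi (bmfun_cst _ _))) H.
apply: le_trans (H _).
  rewrite lee_fin RintegralB//; first last.
  - exact: bmfun_integrable (bmfun_cst _ _).
  - exact: bmfun_integrable.
  rewrite Rintegral_cst_prob lerD2r; apply: le_Rintegral => //.
    exact: bmfun_integrable.
  by move=> x _; case: hM => M hM; apply: (infconv_ge lam_ge0 hM).
under eq_Rintegral do rewrite expRB.
rewrite RintegralZr//; last exact: bmfun_integrable (bmfun_expR _).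
by rewrite ler_pdivrMr ?expR_gt0// mul1r; exact: exp_le.
Qed.

(** The balls of integer radius increase to the whole space, so their masses tend to 1. *)
Let exists_ball x0 : exists r : R, 0 <= r /\
  \int[mu]_x (if d x x0 < r then 0 else 1) <= 1/2.
Proof.
pose B (n : nat) := [set x | d x x0 < n%:R].
have mB n : measurable (B n).
  apply: (dopen_measurable pd) => x /= xa.
  exists (n%:R - d x x0); split; first by rewrite subr_gt0.
  by move=> z xz; have := dtri z x x0; rewrite /B/= (dC z x); lra.
have UB : \bigcup_n B n = [set: X].
  apply/seteqP; split=> // x _; exists (Num.truncn (d x x0)).+1 => //=.
  exact: truncnS_gt.
have ndB : nondecreasing_seq B.
  move=> a b ab; apply/subsetPset => x /=; rewrite /B /= => h.
  by apply: lt_le_trans h _; rewrite ler_nat.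
have : (mu \o B) n @[n --> \oo] --> (1%E : \bar R).
  have -> : 1%E = mu (\bigcup_n B n) by rewrite UB; apply/esym; exact: probability_setT.
  exact: nondecreasing_cvg_mu (bigcupT_measurable _ mB) ndB.
move=> /fine_cvgP[_ /cvgrPdist_lt /(_ (1/2))].
case=> // n _ /(_ n (leqnn _)) /=; rewrite ltr_norml => /andP[_ hn].
exists n%:R; split; first exact: ler0n.
rewrite (_ : (fun x => _) = (fun x => 1 - \1_(B n) x)); last first.
  apply/funext => x; rewrite indicE; case: ifPn => h.
    by rewrite mem_set// subrr.
  by rewrite memNset ?subr0//; exact/negP.
have bI : bmfun (\1_(B n) : X -> R).
  split; first exact: measurable_indic.
  exists 1 => x; rewrite indicE; by case: (x \in _); rewrite ?normr1 ?normr0.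
rewrite RintegralB//; [|exact: bmfun_integrable (bmfun_cst _ _)|exact: bmfun_integrable].
rewrite Rintegral_cst_prob {1}/Rintegral integral_indic// setIT; lra.
Qed.

(** Testing [exp_le] on [n] times the indicator of the complement of a ball of mass at least 1/2
    bounds the integral of [e^(min (q, n))] by [e^(n/2)]. This yields exponentially small tails for
    [q], hence its integrability. *)
Lemma second_moment x0 : mu.-integrable setT (EFin \o (fun x => d x x0 ^+ 2)).
Proof.
have [r [r0 half]] := exists_ball x0.
pose q x := lam * Num.max (d x x0 - r) 0 ^+ 2.
have md : measurable_fun [set: X] (fun x => d x x0) by exact: measurable_dist.
have mq : measurable_fun [set: X] q.
  apply: measurable_funM => //; apply: measurable_funX.
  by apply: measurable_maxr => //; exact: measurable_funB.
have q0 x : 0 <= q x by rewrite mulr_ge0// sqr_ge0.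
have bq n : bmfun (fun x => Num.min (q x) n%:R).
  split; first exact: measurable_minr.
  exists n%:R => x; rewrite ger0_norm ?le_min ?q0 ?ler0n// ge_min.
  by rewrite lexx orbT.
have bI : bmfun (fun x => if d x x0 < r then 0 else 1 : R).
  split.
    by apply: measurable_fun_ifT => //; exact: measurable_fun_ltr.
  by exists 1 => x; case: ifP; rewrite ?normr0 ?normr1.
have tail n : \int[mu]_x expR (Num.min (q x) n%:R) <= expR (n%:R / 2).
  pose h x : R := n%:R * (if d x x0 < r then 0 else 1).
  have bh : bmfun h by exact: bmfunZ.
  have [_ [M hM]] := bh.
  apply: (@le_trans _ _ (\int[mu]_x expR (infconv d lam h x))).
    apply: le_Rintegral => //; first exact: bmfun_integrable (bmfun_expR _).
      apply: bmfun_integrable; apply: bmfun_expR; apply: infconv_bmfun => //.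
      by exists M.
    (* Outside the ball [h y] is already [n]; inside it the triangle inequality gives
       [d x y >= d x x0 - r]. *)
    move=> x _; rewrite ler_expR; apply: (infconv_ge lam_ge0 hM) => y.
    have l0 : 0 <= lam * d x y ^+ 2 by rewrite mulr_ge0// sqr_ge0.
    rewrite /h ge_min; case: ifPn => yr; last by rewrite mulr1 lerDl l0 orbT.
    rewrite mulr0 add0r; apply/orP; left; apply: ler_wpM2l => //.
    apply: lerXn2r; rewrite ?nnegrE// ?le_max ?lexx ?orbT//.
    by rewrite ge_max d_ge0 andbT; have := dtri x y x0; lra.
  apply: (le_trans (exp_le bh)); rewrite ler_expR RintegralZl//.
    by rewrite ler_wpM2l//; lra.
  exact: bmfun_integrable.
pose rho : R := expR (- (1/2)).
have rho1 : rho < 1 by rewrite expR_lt1; lra.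
have rhon n : rho ^+ n = expR (- (n%:R / 2)).
  by rewrite /rho -expRM_natl; congr expR; lra.
(* Raising the truncation level from [n] to [n + 1] adds at most [e^(min (q, n) - n)], of integral
   at most [rho ^+ n]: a geometric series. *)
have step n : \int[mu]_x Num.min (q x) n%:R <= (1 - rho ^+ n) / (1 - rho).
  elim: n => [|n IH].
    rewrite expr0 subrr mul0r -(Rintegral_cst_prob mu 0) le_eqVlt; apply/orP; left.
    by apply/eqP/eq_Rintegral => x _; apply/min_idPr.
  apply: (@le_trans _ _ (\int[mu]_x (Num.min (q x) n%:R +
      expR (- n%:R) * expR (Num.min (q x) n%:R)))).
    apply: le_Rintegral => //; first exact: bmfun_integrable.
      apply: bmfun_integrable; apply: bmfunD => //.
      by apply: bmfunZ; exact: bmfun_expR.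
    move=> x _; rewrite -expRD; have [qn|qn] := leP (q x) n%:R.
      by rewrite (min_idPl _) ?lerDl ?expR_ge0// (le_trans qn)// ler_nat.
    by rewrite addNr expR0 natr1 ge_min lexx orbT.
  rewrite RintegralD//; last 2 first.
  - exact: bmfun_integrable.
  - by apply: bmfun_integrable; apply: bmfunZ; exact: bmfun_expR.
  rewrite RintegralZl//; last exact: bmfun_integrable (bmfun_expR _).
  have t : expR (- n%:R) * \int[mu]_x expR (Num.min (q x) n%:R) <= rho ^+ n.
    rewrite rhon; apply: (le_trans (ler_wpM2l (expR_ge0 _) (tail n))).
    by rewrite -expRD ler_expR; lra.
  apply: (le_trans (lerD IH t)); rewrite le_eqVlt; apply/orP; left; apply/eqP.
  by rewrite exprS; field; rewrite subr_eq0 eq_sym lt_eqF.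
have iq : mu.-integrable setT (EFin \o q).
  apply: (integrable_of_truncations (K := (1 - rho)^-1)) => // n.
  apply: (le_trans (step n)); rewrite ler_pdivrMr ?subr_gt0//.
  rewrite mulVf ?subr_eq0 1?eq_sym ?lt_eqF//.
  by rewrite gerBl exprn_ge0// expR_ge0.
have ib : mu.-integrable setT (EFin \o (fun x => 2 / lam * q x + 2 * r ^+ 2)).
  have i1 := integrableZl measurableT (2 / lam) iq.
  have i2 := bmfun_integrable mu (bmfun_cst X (2 * r ^+ 2)).
  by apply: eq_integrable (integrableD _ i1 i2) => // x _; rewrite /= EFinD EFinM.
apply: le_integrable ib => //; first by apply/measurable_EFinP/measurable_funX.
move=> x _; rewrite lee_fin ger0_norm ?sqr_ge0// (le_trans _ (ler_norm _))//.
rewrite /q mulrA divfK ?gt_eqF//.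
set m := Num.max _ _.
have m1 : d x x0 - r <= m by rewrite le_max lexx.
have m0 : 0 <= m by rewrite le_max lexx orbT.
have : d x x0 ^+ 2 <= (m + r) ^+ 2.
  by apply: lerXn2r; rewrite ?nnegrE ?addr_ge0//; lra.
have := sqr_ge0 (m - r); nra.
Qed.

(** [dual_bound] with truncations at [n] of [lam / 2 * d x x0 ^+ 2] and [lam * d y x0 ^+ 2]; the
    constraint is [d x x0 ^+ 2 <= 2 * d x y ^+ 2 + 2 * d y x0 ^+ 2]. *)
Lemma second_moment_density (nu : probability X R) (g : X -> R) x0 :
  is_density mu nu g -> (\int[mu]_x (g x * ln (g x))%:E < +oo)%E ->
  nu.-integrable setT (EFin \o (fun x => d x x0 ^+ 2)).
Proof.
move=> gd Hoo.
have H0 := entropy_ge0 gd.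
have HE : (\int[mu]_x (g x * ln (g x))%:E)%E =
    (fine (\int[mu]_x (g x * ln (g x))%:E)%E)%:E.
  by rewrite fineK// ge0_fin_numE.
set H := fine _ in HE.
have md : measurable_fun [set: X] (fun x => d x x0 ^+ 2).
  by apply: measurable_funX; exact: measurable_dist.
have bt (c : R) n : 0 <= c -> bmfun (fun x => Num.min (c * d x x0 ^+ 2) n%:R).
  move=> c0; split; first by apply: measurable_minr => //; exact: measurable_funM.
  exists n%:R => x; rewrite ger0_norm; first by rewrite ge_min lexx orbT.
  by rewrite le_min ler0n mulr_ge0// sqr_ge0.
have l2 : 0 <= lam / 2 by rewrite divr_ge0.
have im := second_moment x0.
have i : nu.-integrable setT (EFin \o (fun x => lam / 2 * d x x0 ^+ 2)).
  apply: (integrable_of_truncations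
    (K := H + lam * \int[mu]_x (d x x0 ^+ 2))) => [|x|n].
  - exact: measurable_funM.
  - by rewrite mulr_ge0// sqr_ge0.
  have := @dual_bound nu g _ _ gd (bmfun_integrable nu (bt _ n l2)) (bt lam n lam_ge0).
  rewrite HE lee_fin => D1.
  have D2 : \int[mu]_x Num.min (lam * d x x0 ^+ 2) n%:R <= lam * \int[mu]_x (d x x0 ^+ 2).
    rewrite -RintegralZl//; apply: le_Rintegral => //.
    - by apply: bmfun_integrable; exact: bt.
    - by have := integrableZl measurableT lam im; apply: eq_integrable => // x _.
    - by move=> x _; rewrite ge_min lexx.
  rewrite -lerBlDr; apply: le_trans (D1 _); first by rewrite lerD2l lerN2.
  move=> x y; have l0 : 0 <= lam * d x y ^+ 2 by rewrite mulr_ge0// sqr_ge0.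
  have [yn|yn] := leP (lam * d y x0 ^+ 2) n%:R; last by rewrite ge_min lerDl l0 orbT.
  rewrite ge_min; apply/orP; left.
  have t2 : d x x0 ^+ 2 <= (d x y + d y x0) ^+ 2.
    by apply: lerXn2r; rewrite ?nnegrE ?addr_ge0.
  have := sqr_ge0 (d x y - d y x0).
  have := ler_wpM2l l2 t2; nra.
have := integrableZl measurableT (2 / lam) i.
apply: eq_integrable => // x _ /=; rewrite -EFinM; congr (_%:E).
by field; rewrite gt_eqF.
Qed.

End moments.

(** * Step functions, couplings with prescribed weights, quantisation *)

Lemma ge0_integral_step (dd : measure_display) (T : measurableType dd)
    (R : realType) (m : {measure set T -> \bar R}) (I : finType)
    (A : I -> set T) (v : I -> R) (E : set T) :
  (forall i, measurable (A i)) -> (forall i, 0 <= v i) -> measurable E ->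
  (\int[m]_(x in E) (\sum_i v i * \1_(A i) x)%:E =
   \sum_i (v i)%:E * m (A i `&` E))%E.
Proof.
move=> mA v0 mE.
have mi i : measurable_fun E (fun x => (v i * \1_(A i) x)%:E).
  by apply/measurable_EFinP/measurable_funM => //; exact: measurable_indic.
under eq_integral do rewrite -sumEFin.
rewrite ge0_integral_sum//; last first.
  by move=> i x _; rewrite lee_fin mulr_ge0// indicE.
apply: eq_bigr => i _; under eq_integral do rewrite EFinM.
rewrite ge0_integralZl_EFin//; first by rewrite integral_indic.
by apply/measurable_EFinP; exact: measurable_indic.
Qed.

Lemma sum_fibre_indic (R : realType) (T : Type) (I : finType) (t : T -> I)
    (v : I -> R) x : \sum_i v i * \1_(t @^-1` [set i]) x = v (t x).
Proof.
rewrite (bigD1 (t x))//= big1 => [|i /eqP ti].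
  by rewrite indicE mem_set//= mulr1 addr0.
by rewrite indicE memNset ?mulr0//= => /esym.
Qed.

Section fibres.
Context (R : realType) (dd : measure_display) (X : measurableType dd).
Variables (I : finType) (t : X -> I).
Hypothesis mt : forall i, measurable (t @^-1` [set i]).

Lemma sum_fibre_probability (P : probability X R) (E : set X) : measurable E ->
  \sum_i fine (P (t @^-1` [set i] `&` E)) = fine (P E).
Proof.
move=> mE; have := @ge0_integral_step _ _ _ P _ _ (fun=> 1) E mt (fun=> ler01) mE.
under eq_integral do rewrite sum_fibre_indic.
rewrite integral_cst// mul1e => PE; apply: EFin_inj.
rewrite fineK ?fin_num_measure// -sumEFin [RHS]PE; apply: eq_bigr => i _.
by rewrite mul1e fineK// fin_num_measure//; exact: measurableI.
Qed.

Lemma bmfun_fibre (v : I -> R) : bmfun (fun x => v (t x)).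
Proof.
split.
  rewrite (_ : (fun x => v (t x)) =
      (fun x => \sum_i v i * \1_(t @^-1` [set i]) x)); last first.
    by apply/funext => x; rewrite sum_fibre_indic.
  apply: measurable_sum => i; apply: measurable_funM; first exact: measurable_cst.
  exact: (measurable_indic (mt i)).
by exists (\sum_i `|v i|) => x; rewrite (bigD1 (t x))//= lerDl sumr_ge0.
Qed.

Lemma Rintegral_fibre (P : probability X R) (v : I -> R) :
  \int[P]_x v (t x) = \sum_i v i * fine (P (t @^-1` [set i])).
Proof.
have ge0 (u : I -> R) : (forall i, 0 <= u i) ->
    \int[P]_x u (t x) = \sum_i u i * fine (P (t @^-1` [set i])).
  move=> u0; apply: EFin_inj; rewrite -bmfun_integralE; last exact: bmfun_fibre.
  under eq_integral do rewrite -sum_fibre_indic.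
  rewrite ge0_integral_step// -sumEFin; apply: eq_bigr => i _.
  by rewrite setIT EFinM fineK// fin_num_measure.
pose B := \sum_i `|v i|.
have vB i : 0 <= v i + B.
  have : `|v i| <= B by rewrite /B (bigD1 i)//= lerDl sumr_ge0.
  by rewrite ler_norml => /andP[]; lra.
have := ge0 _ vB; rewrite RintegralD//; first last.
- exact: bmfun_integrable (bmfun_cst _ _).
- exact: bmfun_integrable (bmfun_fibre _).
rewrite Rintegral_cst_prob; under [X in _ = X -> _]eq_bigr do rewrite mulrDl.
rewrite big_split/= -mulr_sumr; under [X in _ + B * X]eq_bigr do rewrite -[_ @^-1` _]setIT.
rewrite sum_fibre_probability// [fine _](_ : _ = 1) ?mulr1; first exact: addIr.
by rewrite -[RHS]/(fine 1%E); congr fine; exact: probability_setT.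
Qed.

End fibres.

(** Summing over [j] cancels [b j] and leaves [a i * (al i / a i)]. Null cells are harmless:
    division by zero returns 0, and [p] vanishes wherever a marginal does. *)
Lemma transport_weights (R : realType) (k : nat) (p : 'I_k -> 'I_k -> R)
    (a b al : 'I_k -> R) :
  (forall i j, 0 <= p i j) -> (forall i, \sum_j p i j = a i) ->
  (forall j, \sum_i p i j = b j) -> (forall i, 0 <= al i <= a i) ->
  \sum_i \sum_j p i j / (a i * b j) * (al i * b j) = \sum_i al i.
Proof.
move=> p0 pa pb ale; apply: eq_bigr => i _.
have [ai0|ai0] := eqVneq (a i) 0.
  have al0 : al i = 0 by apply/eqP; rewrite eq_le; have := ale i; rewrite ai0 andbC.
  by rewrite al0; apply: big1 => j _; rewrite mul0r mulr0.
transitivity (\sum_j p i j * (al i / a i)); last first.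
  by rewrite -mulr_suml pa mulrC divfK.
apply: eq_bigr => j _; have [bj0|bj0] := eqVneq (b j) 0.
  have pij : p i j = 0.
    apply/eqP; rewrite eq_le p0 andbT -bj0 -pb (bigD1 i)//= lerDl.
    by apply: sumr_ge0.
  by rewrite pij !mul0r.
by field; rewrite ai0 bj0.
Qed.

Section coupling_of_weights.
Context (R : realType) (dd : measure_display) (X : measurableType dd).
Variables (nu mu : probability X R) (k : nat) (t : X -> 'I_k).
Variable (p : 'I_k -> 'I_k -> R).

Let A i := t @^-1` [set i].

Hypothesis (mA : forall i, measurable (A i)).
Hypothesis (p0 : forall i j, 0 <= p i j).
Hypothesis (pnu : forall i, \sum_j p i j = fine (nu (A i))).
Hypothesis (pmu : forall j, \sum_i p i j = fine (mu (A j))).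

Let a i := fine (nu (A i)).
Let b i := fine (mu (A i)).
(** The constant density of the coupling with respect to [nu \x mu] on one rectangle of cells. *)
Let w (q : 'I_k * 'I_k) := p q.1 q.2 / (a q.1 * b q.2).
Let C (q : 'I_k * 'I_k) := A q.1 `*` A q.2.

Let w0 q : 0 <= w q.
Proof. by rewrite divr_ge0// mulr_ge0// fine_ge0. Qed.

Let mC q : measurable (C q). Proof. exact: measurableX. Qed.

Let dens z := \sum_q w q * \1_(C q) z.

Let weights_rect (E F : set X) : measurable E -> measurable F ->
  (\sum_q (w q)%:E * (nu \x mu)%E (C q `&` (E `*` F)) =
   (\sum_i \sum_j p i j / (a i * b j) *
      (fine (nu (A i `&` E)) * fine (mu (A j `&` F))))%:E)%E.
Proof.
move=> mE mF; rewrite pair_bigA/= -sumEFin; apply: eq_bigr => -[i j] _ /=.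
rewrite /C/= -setXI product_measure1E//; [|exact: measurableI..].
rewrite [RHS]EFinM; congr (_ * _)%E.
by rewrite EFinM !fineK// fin_num_measure//; exact: measurableI.
Qed.

Let al_le (P : probability X R) E i : measurable E ->
  0 <= fine (P (A i `&` E)) <= fine (P (A i)).
Proof.
move=> mE; rewrite fine_ge0//= fine_le ?fin_num_measure//; first exact: measurableI.
by apply: le_measure; rewrite ?inE//; exact: measurableI.
Qed.

Let rect_nu E : measurable E ->
  (\sum_q (w q)%:E * (nu \x mu)%E (C q `&` (E `*` setT)) = nu E)%E.
Proof.
move=> mE; rewrite weights_rect//.
under eq_bigr do under eq_bigr do rewrite setIT.
rewrite transport_weights//; last by move=> i; exact: al_le.
by rewrite (sum_fibre_probability mA)// fineK// fin_num_measure.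
Qed.

Let rect_mu E : measurable E ->
  (\sum_q (w q)%:E * (nu \x mu)%E (C q `&` (setT `*` E)) = mu E)%E.
Proof.
move=> mE; rewrite weights_rect//.
rewrite exchange_big/=.
transitivity ((\sum_j \sum_i p i j / (b j * a i) * (fine (mu (A j `&` E)) * a i))%:E).
  congr (_%:E); apply: eq_bigr => j _; apply: eq_bigr => i _.
  by rewrite setIT; congr (_ / _ * _); exact: mulrC.
rewrite (@transport_weights _ _ (fun j i => p i j))//; last by move=> i; exact: al_le.
by rewrite (sum_fibre_probability mA)// fineK// fin_num_measure.
Qed.

Lemma coupling_of_weights : exists pi : probability (X * X)%type R,
  coupling nu mu pi /\ forall i j, pi (A i `*` A j) = (p i j)%:E.
Proof.
have mdens : measurable_fun [set: X * X] dens.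
  apply: measurable_sum => q; apply: measurable_funM; first exact: measurable_cst.
  exact: (measurable_indic (mC q)).
have dens0 z : 0 <= dens z.
  by apply: sumr_ge0 => q _; rewrite mulr_ge0// indicE.
have piE E : measurable E -> (\int[nu \x mu]_(z in E) (dens z)%:E =
    \sum_q (w q)%:E * (nu \x mu)%E (C q `&` E))%E.
  by move=> mE; exact: ge0_integral_step.
have int1 : (\int[nu \x mu]_z (dens z)%:E = 1)%E.
  by rewrite piE// -setXTT rect_nu//; exact: probability_setT.
have [pi piP] := probability_of_density mdens dens0 int1.
exists pi; split=> [E F mE mF|i j].
  have mEF := measurableX mE (@measurableT _ X); have mFE := measurableX (@measurableT _ X) mF.
  by split; [rewrite (piP _ mEF) (piE _ mEF) rect_nu|rewrite (piP _ mFE) (piE _ mFE) rect_mu].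
have mij := measurableX (mA i) (mA j); rewrite (piP _ mij) (piE _ mij).
rewrite weights_rect//; congr (_%:E).
rewrite (bigD1 i)//= [X in _ + X]big1 => [|i' /eqP ne]; last first.
  apply: big1 => j' _; rewrite (_ : A i' `&` A i = set0) ?measure0 ?mul0r ?mulr0//.
  by apply/seteqP; split=> // x [h1 h2]; apply: ne; exact: etrans (esym h1) h2.
rewrite addr0 (bigD1 j)//= [X in _ + X]big1 => [|j' /eqP ne]; last first.
  rewrite (_ : A j' `&` A j = set0) ?measure0 ?mulr0//.
  by apply/seteqP; split=> // x [h1 h2]; apply: ne; exact: etrans (esym h1) h2.
rewrite addr0 !setIid -/(a i) -/(b j).
have pa : p i j <= a i by rewrite /a -pnu (bigD1 j)//= lerDl sumr_ge0.
have pb : p i j <= b j by rewrite /b -pmu (bigD1 i)//= lerDl sumr_ge0.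
(* On a null rectangle [p i j] is squeezed to 0 by its two marginals. *)
have [ab0|ab0] := eqVneq (a i * b j) 0; last by rewrite divfK.
apply/eqP; rewrite ab0 mulr0 eq_le p0/=.
by move/eqP: ab0; rewrite mulf_eq0 => /orP[/eqP <-|/eqP <-].
Qed.

End coupling_of_weights.

Section quantisation.
Context (R : realType) (dd : measure_display) (X : measurableType dd).
Variables (d : X -> X -> R) (s : nat -> X) (e : R).
Hypotheses (pd : polish_borel d) (e0 : 0 < e).
Hypothesis dense : forall x, exists n, d x (s n) < e.

(* the last index [i < n] with [d x (s i) < e], and [0] when there is none *)
Fixpoint cell (n : nat) (x : X) : nat :=
  if n is m.+1 then if d x (s m) < e then m else cell m x else 0.

Lemma cell_lt n x : (cell n x < n.+1)%N.
Proof. by elim: n => //= n IH; case: ifP => // _; exact: ltnW. Qed.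

Lemma measurable_cell (dd' : measure_display) (Y : measurableType dd')
    (F : nat -> X -> Y) n :
  (forall i, measurable_fun [set: X] (F i)) ->
  measurable_fun [set: X] (fun x => F (cell n x) x).
Proof.
move=> mF; elim: n => [|n IH] /=; first exact: mF.
rewrite (_ : (fun x => _) =
  (fun x => if d x (s n) < e then F n x else F (cell n x) x)); last first.
  by apply/funext => x; case: ifP.
apply: measurable_fun_ifT => //; apply: measurable_fun_ltr => //.
exact: measurable_dist.
Qed.

Lemma measurable_cell_fibre n i : measurable [set x | cell n x = i].
Proof.
have := @measurable_cell _ nat (fun i _ => i) n (fun i => measurable_cst _).
move=> /(_ measurableT [set i]); rewrite setTI; apply.
by [].
Qed.

Definition cell_err n x := d x (s (cell n x)) ^+ 2.

Lemma cell_err_ge0 n x : 0 <= cell_err n x. Proof. exact: sqr_ge0. Qed.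

Lemma measurable_cell_err n : measurable_fun [set: X] (cell_err n).
Proof.
apply: (@measurable_cell _ R (fun i x => d x (s i) ^+ 2)) => i.
by apply: measurable_funX; exact: measurable_dist.
Qed.

Let d_ge0 x y : 0 <= d x y. Proof. by case: pd => [[]]. Qed.

(** A domination uniform in [n]: the chosen point is within [e] of [x], or it is the default
    [s 0]. *)
Lemma cell_err_le n x : cell_err n x <= e ^+ 2 + d x (s 0) ^+ 2.
Proof.
rewrite /cell_err; elim: n => [|n IH] /=; first by rewrite lerDr sqr_ge0.
case: ifPn => // h; apply: (@le_trans _ _ (e ^+ 2)); last by rewrite lerDl sqr_ge0.
by apply: lerXn2r; rewrite ?nnegrE// ltW.
Qed.

Lemma cell_err_small n x m : (m < n)%N -> d x (s m) < e -> cell_err n x <= e ^+ 2.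
Proof.
rewrite /cell_err => + xm; elim: n => //= n IH; rewrite ltnS leq_eqVlt.
case: ifPn => h; first by move=> _; apply: lerXn2r; rewrite ?nnegrE// ltW.
by case/orP => [/eqP mn|//]; move: h; rewrite -mn xm.
Qed.

Lemma integrable_cell_err (P : probability X R) n :
  P.-integrable setT (EFin \o (fun x => d x (s 0) ^+ 2)) ->
  P.-integrable setT (EFin \o cell_err n).
Proof.
move=> i0; have i1 := bmfun_integrable P (bmfun_cst X (e ^+ 2)).
apply: le_integrable (integrableD _ i1 i0) => //.
  exact/measurable_EFinP/measurable_cell_err.
move=> x _; rewrite /= lee_fin ger0_norm ?cell_err_ge0// ger0_norm; last first.
  by rewrite addr_ge0// sqr_ge0.
exact: cell_err_le.
Qed.

(** By density of [s], the excess of [cell_err n] over [e ^+ 2] is eventually zero at each point,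
    and [d x (s 0) ^+ 2] dominates it: dominated convergence applies. *)
Lemma cell_err_near (P : probability X R) :
  P.-integrable setT (EFin \o (fun x => d x (s 0) ^+ 2)) ->
  \forall n \near \oo, \int[P]_x cell_err n x <= 2 * e ^+ 2.
Proof.
move=> i0; pose f n x := Num.max (cell_err n x - e ^+ 2) 0.
have f_ge0 n x : 0 <= f n x by rewrite le_max lexx orbT.
have f_le n x : f n x <= d x (s 0) ^+ 2.
  by rewrite ge_max sqr_ge0 andbT; have := cell_err_le n x; lra.
have mf n : measurable_fun [set: X] (f n).
  apply: measurable_maxr => //; apply: measurable_funB => //.
  exact: measurable_cell_err.
have iF n : P.-integrable setT (EFin \o f n).
  apply: le_integrable i0 => //; first exact/measurable_EFinP.
  by move=> x _; rewrite lee_fin !ger0_norm ?sqr_ge0.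
have mEf n : measurable_fun [set: X] (EFin \o f n) by exact/measurable_EFinP.
have f_f : {ae P, forall x, [set: X] x -> (EFin \o f n) x @[n --> \oo] --> cst 0%E x}.
  apply: aeW => x _; have [m xm] := dense x; apply: cvg_near_cst.
  exists m.+1 => // n /= mn; congr (_%:E); apply/max_idPr; rewrite subr_le0.
  exact: cell_err_small mn xm.
have f_g : {ae P, forall x n, [set: X] x ->
    (`|(EFin \o f n) x| <= (EFin \o (fun x => d x (s 0) ^+ 2)%R) x)%E}.
  by apply: aeW => x n _; rewrite lee_fin ger0_norm.
have [_ _ cv] := dominated_convergence measurableT mEf (measurable_cst _) f_f i0 f_g.
rewrite integral0 in cv.
have e2 : 0 < e ^+ 2 by rewrite exprn_gt0.
have /fine_cvgP[_ /cvgrPdist_lt /(_ _ e2)] := cv.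
apply: filterS => n /=; rewrite sub0r normrN => h.
have h2 : \int[P]_x f n x <= e ^+ 2 by apply: ltW; exact: le_lt_trans (ler_norm _) h.
apply: (@le_trans _ _ (\int[P]_x (f n x + e ^+ 2))).
  apply: le_Rintegral => //; first exact: integrable_cell_err.
    have i1 := bmfun_integrable P (bmfun_cst X (e ^+ 2)).
    by apply: eq_integrable (integrableD _ (iF n) i1) => // x _; rewrite /= EFinD.
  by move=> x _; rewrite -lerBlDr le_max lexx.
rewrite RintegralD//; last exact: bmfun_integrable (bmfun_cst _ _).
by rewrite Rintegral_cst_prob; lra.
Qed.

End quantisation.

(** * Near-optimal couplings *)

Lemma dense_sequence (R : realType) (dd : measure_display) (X : measurableType dd)
    (d : X -> X -> R) : [set: X] !=set0 -> dseparable d ->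
  exists s : nat -> X, forall (e : R) x, 0 < e -> exists n, d x (s n) < e.
Proof.
move=> [x0 _] [S [/countable_injP[f finj] dS]].
exists (fun n => xget x0 [set y | S y /\ f y = n]) => e x e0.
have [y [Sy xy]] := dS x e e0; exists (f y).
case: xgetP => [z _ [Sz fz]|/(_ y) []//].
by rewrite (finj z y)// inE.
Qed.

Section coupling_marginals.
Context (R : realType) (dd : measure_display) (X : measurableType dd).
Variables (nu mu : probability X R) (pi : probability (X * X)%type R).
Hypothesis cpl : coupling nu mu pi.

Lemma integral_coupling_fst (f : X -> \bar R) : measurable_fun [set: X] f ->
  (forall x, (0 <= f x)%E) -> (\int[pi]_z f z.1 = \int[nu]_x f x)%E.
Proof.
move=> mf f0.
have := @ge0_integral_pushforward _ _ _ _ _ fst (@measurable_fst _ _ X X) pi setT f.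
rewrite preimage_setT => /(_ measurableT mf (fun x _ => f0 x)) <-.
apply: eq_measure_integral => A mA _.
have [h1 _] := cpl mA measurableT; apply: etrans h1; rewrite /pushforward; congr (pi _).
by apply/seteqP; split=> z //= [].
Qed.

Lemma integral_coupling_snd (f : X -> \bar R) : measurable_fun [set: X] f ->
  (forall x, (0 <= f x)%E) -> (\int[pi]_z f z.2 = \int[mu]_x f x)%E.
Proof.
move=> mf f0.
have := @ge0_integral_pushforward _ _ _ _ _ snd (@measurable_snd _ _ X X) pi setT f.
rewrite preimage_setT => /(_ measurableT mf (fun x _ => f0 x)) <-.
apply: eq_measure_integral => A mA _.
have [_ h1] := cpl measurableT mA; apply: etrans h1; rewrite /pushforward; congr (pi _).
by apply/seteqP; split=> z //= [].
Qed.

End coupling_marginals.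

(** Young's inequality [2 a (b + c) <= eta a^2 + (b + c)^2 / eta] keeps the factor of [a ^+ 2] close
    to 1 and charges [1 / eta] to the quantisation errors. *)
Lemma sqr_le_split (R : realType) (eta D a b c : R) : 0 < eta -> 0 <= D ->
  D <= b + a + c -> D ^+ 2 <= (1 + eta) * (a ^+ 2 + 2 / eta * (b ^+ 2 + c ^+ 2)).
Proof.
move=> eta0 D0 Dle.
have h1 : D ^+ 2 <= (b + a + c) ^+ 2 by apply: lerXn2r; rewrite ?nnegrE//; lra.
apply: (le_trans h1); rewrite -(ler_pM2l eta0).
have -> : eta * ((1 + eta) * (a ^+ 2 + 2 / eta * (b ^+ 2 + c ^+ 2))) =
  (1 + eta) * (eta * a ^+ 2 + 2 * (b ^+ 2 + c ^+ 2)) by field; rewrite gt_eqF.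
have := sqr_ge0 (eta * a - (b + c)); have := sqr_ge0 (b - c).
have k : 0 <= eta * (b - c) ^+ 2 by rewrite mulr_ge0 ?sqr_ge0// ltW.
by move: k; nra.
Qed.

Section near_optimal_coupling.
Context (R : realType) (dd : measure_display) (X : measurableType dd).
Variables (d : X -> X -> R) (mu nu : probability X R) (lam : R) (g : X -> R).
Hypotheses (pd : polish_borel d) (lam_gt0 : 0 < lam).
Hypothesis exp_le : forall h : X -> R, bmfun h ->
  \int[mu]_x expR (infconv d lam h x) <= expR (\int[mu]_x h x).
Hypothesis gd : is_density mu nu g.
Variable H : R.
Hypothesis HE : (\int[mu]_x (g x * ln (g x))%:E)%E = H%:E.

Let dP : is_metric d. Proof. by case: pd. Qed.
Let d_ge0 x y : 0 <= d x y. Proof. by case: dP. Qed.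
Let dC x y : d x y = d y x. Proof. by case: dP. Qed.
Let dtri x y z : d x z <= d x y + d y z. Proof. by case: dP. Qed.

Section cells.
Variables (I : nat) (t : X -> 'I_I) (pt : 'I_I -> X) (eta : R).
Hypothesis eta0 : 0 < eta.
Hypothesis mt : forall i, measurable (t @^-1` [set i]).

Let err x := d x (pt (t x)) ^+ 2.

Hypothesis merr : measurable_fun [set: X] err.
Hypothesis inu : nu.-integrable setT (EFin \o err).
Hypothesis imu : mu.-integrable setT (EFin \o err).

Let K := 2 * lam / eta.
(** The discount [1 + eta] makes the cost between representatives at most [lam * d x y ^+ 2] plus
    [K] times the errors. *)
Let c i j := lam / (1 + eta) * d (pt i) (pt j) ^+ 2.
Let toterr := \int[nu]_x err x + \int[mu]_x err x.

Let K0 : 0 <= K.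
Proof. by rewrite /K divr_ge0 ?mulr_ge0// ltW. Qed.

Let eta1 : 0 < 1 + eta. Proof. by rewrite addr_gt0. Qed.

Let c0 i j : 0 <= c i j.
Proof. by rewrite mulr_ge0 ?sqr_ge0// divr_ge0// ltW. Qed.

Let err0 x : 0 <= err x. Proof. exact: sqr_ge0. Qed.

Let c_le x y : c (t x) (t y) <= lam * d x y ^+ 2 + K * (err x + err y).
Proof.
have h : d (pt (t x)) (pt (t y)) <= d x (pt (t x)) + d x y + d y (pt (t y)).
  have := dtri (pt (t x)) x (pt (t y)); have := dtri x y (pt (t y)).
  rewrite (dC _ x); lra.
have := sqr_le_split eta0 (d_ge0 _ _) h; rewrite -/(err x) -/(err y) => h2.
rewrite /c mulrAC ler_pdivrMr//.
have -> : (lam * d x y ^+ 2 + K * (err x + err y)) * (1 + eta) =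
  lam * ((1 + eta) * (d x y ^+ 2 + 2 / eta * (err x + err y))).
  by rewrite /K; field; rewrite gt_eqF.
by rewrite ler_pM2l.
Qed.

Let d_le x y : d x y ^+ 2 <=
  (1 + eta) / lam * ((1 + eta) * c (t x) (t y) + K * (err x + err y)).
Proof.
have h : d x y <= d x (pt (t x)) + d (pt (t x)) (pt (t y)) + d y (pt (t y)).
  have := dtri x (pt (t x)) y; have := dtri (pt (t x)) (pt (t y)) y.
  rewrite (dC (pt (t y)) y); lra.
have := sqr_le_split eta0 (d_ge0 _ _) h; rewrite -/(err x) -/(err y) => h2.
apply: (le_trans h2); rewrite le_eqVlt; apply/orP; left; apply/eqP.
by rewrite /c /K; field; rewrite !gt_eqF.
Qed.

(** By [c_le], the functions [u (t x) - K * err x] and [w (t y) + K * err y] are feasible for the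
    cost [lam * d x y ^+ 2], so [dual_bound] applies; the corrections cost [K * toterr]. *)
Let dual_le (u w : 'I_I -> R) : (forall i j, u i - w j <= c i j) ->
  \sum_i u i * fine (nu (t @^-1` [set i])) -
  \sum_j w j * fine (mu (t @^-1` [set j])) <= H + K * toterr.
Proof.
move=> uw; rewrite -!(Rintegral_fibre mt).
pose N := \sum_i `|u i| + \sum_j `|w j|.
have uN i : u i <= N.
  apply: (le_trans (ler_norm _)); rewrite /N (bigD1 i)//= -addrA lerDl.
  by rewrite addr_ge0 ?sumr_ge0.
have wN j : - N <= w j.
  rewrite lerNl; apply: (le_trans (ler_norm _)); rewrite normrN.
  apply: (@le_trans _ _ (\sum_k `|w k|)); last by rewrite lerDr sumr_ge0.
  by rewrite (bigD1 j)//= lerDl sumr_ge0.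
have N0 : 0 <= N by rewrite addr_ge0 ?sumr_ge0.
pose f y := w (t y) + K * err y.
(* [dual_bound] asks for a bounded [h]; truncation at [N] preserves feasibility because
   [u (t x) - K * err x <= N]. *)
pose h y := Num.min (f y) N.
have bu := bmfun_fibre mt u; have bw := bmfun_fibre mt w.
have mKerr : measurable_fun [set: X] (fun y => K * err y).
  by apply: measurable_funM => //; exact: measurable_cst.
have mf : measurable_fun [set: X] f.
  by apply: measurable_funD => //; case: bw.
have Kerr0 x : 0 <= K * err x by rewrite mulr_ge0.
have bh : bmfun h.
  split; first exact: measurable_minr.
  exists N => x; rewrite ler_norml; apply/andP; split; last by rewrite ge_min lexx orbT.
  rewrite le_min; apply/andP; split; last by move: N0; lra.
  by rewrite /f; move: (wN (t x)) (Kerr0 x); lra.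
have iKnu : nu.-integrable setT (EFin \o (fun x => K * err x)).
  by have := integrableZl measurableT K inu; apply: eq_integrable => // x _.
have iKmu : mu.-integrable setT (EFin \o (fun x => K * err x)).
  by have := integrableZl measurableT K imu; apply: eq_integrable => // x _.
have iphi : nu.-integrable setT (EFin \o (fun x => u (t x) - K * err x)).
  have := integrableB measurableT (bmfun_integrable nu bu) iKnu.
  by apply: eq_integrable => // x _.
have if_ : mu.-integrable setT (EFin \o f).
  have := integrableD measurableT (bmfun_integrable mu bw) iKmu.
  by apply: eq_integrable => // x _.
have phih x y : u (t x) - K * err x <= h y + lam * d x y ^+ 2.
  have l0 : 0 <= lam * d x y ^+ 2 by rewrite mulr_ge0 ?sqr_ge0// ltW.
  rewrite -lerBlDr le_min; apply/andP; split.
    by rewrite /f; move: (uw (t x) (t y)) (c_le x y); rewrite mulrDr; lra.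
  by move: (uN (t x)) (Kerr0 x); lra.
have := dual_bound pd lam_gt0 exp_le gd iphi bh phih.
rewrite HE lee_fin RintegralB//; last exact: bmfun_integrable.
rewrite RintegralZl//.
have : \int[mu]_x h x <= \int[mu]_x f x.
  apply: le_Rintegral => //; first exact: bmfun_integrable.
  by move=> x _; rewrite ge_min lexx.
rewrite RintegralD//; last exact: bmfun_integrable.
rewrite RintegralZl// /toterr mulrDr.
move: (\int[mu]_x _) (\int[nu]_x _) (\int[mu]_x _) (\int[mu]_x _) (\int[nu]_x _).
move=> r1 r2 r3 r4 r5; lra.
Qed.

(** The three [ep] cover the duality gap, the error of the dual bound, and the return from
    representatives to points by [d_le]. *)
Lemma W2sq_le_cells (ep : R) : 0 < ep -> K * toterr <= ep ->
  (W2sq d nu mu <= ((1 + eta) ^+ 2 / lam * (H + 3 * ep))%:E)%E.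
Proof.
move=> ep0 Kerr.
pose a i := fine (nu (t @^-1` [set i])); pose b i := fine (mu (t @^-1` [set i])).
have sum1 (P : probability X R) : \sum_i fine (P (t @^-1` [set i])) = 1.
  have := @sum_fibre_probability _ _ _ _ _ mt P setT measurableT.
  under eq_bigr do rewrite setIT.
  by move=> ->; rewrite -[RHS]/(fine 1%E); congr fine; exact: probability_setT.
have a0 i : 0 <= a i by exact: fine_ge0.
have b0 i : 0 <= b i by exact: fine_ge0.
have [u [w [p [p0 pa pb uw le]]]] :=
  finite_transport_duality ep0 a0 b0 (sum1 nu) (sum1 mu) c0.
have [pi [cpl piE]] := coupling_of_weights mt p0 pa pb.
have dual := dual_le uw.
apply: (@le_trans _ _ (\int[pi]_z (d z.1 z.2 ^+ 2)%:E)%E).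
  by apply: ereal_inf_lbound; exists pi.
pose k1 := (1 + eta) / lam.
have k10 : 0 <= k1 by rewrite divr_ge0// ltW.
pose G1 (z : X * X) := c (t z.1) (t z.2).
pose G (z : X * X) := (1 + eta) * G1 z + (K * err z.1 + K * err z.2).
have mprod (q : 'I_I * 'I_I) :
    measurable ((fun z : X * X => (t z.1, t z.2)) @^-1` [set q]).
  rewrite (_ : _ @^-1` _ = (t @^-1` [set q.1]) `*` (t @^-1` [set q.2])).
    exact: measurableX.
  by apply/seteqP; split=> -[x y] /=; case: q => q1 q2 /= [-> ->].
have G1E : (\int[pi]_z (G1 z)%:E = (\sum_i \sum_j p i j * c i j)%:E)%E.
  have v0 (q : 'I_I * 'I_I) : 0 <= c q.1 q.2 by [].
  have := @ge0_integral_step _ _ _ pi _ _ _ _ mprod v0 measurableT.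
  under eq_integral do rewrite sum_fibre_indic.
  move=> ->; rewrite pair_bigA/= -sumEFin; apply: eq_bigr => -[i j] _ /=.
  rewrite setIT [RHS]EFinM -piE [LHS]muleC; congr (pi _ * _)%E.
  by apply/seteqP; split=> -[x y] /= [-> ->].
have mG1 : measurable_fun [set: X * X] G1.
  rewrite (_ : G1 = (fun z => \sum_(q : 'I_I * 'I_I) c q.1 q.2 *
      \1_((fun z : X * X => (t z.1, t z.2)) @^-1` [set q]) z)).
    apply: measurable_sum => q; apply: measurable_funM; first exact: measurable_cst.
    exact: (measurable_indic (mprod q)).
  by apply/funext => z; rewrite (sum_fibre_indic _ (fun q : 'I_I * 'I_I => c q.1 q.2)).
have mE : measurable_fun [set: X] (fun x => (K * err x)%:E).
  by apply/measurable_EFinP; apply: measurable_funM => //; exact: measurable_cst.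
have E0 x : (0 <= (K * err x)%:E)%E by rewrite lee_fin mulr_ge0.
have mE1 : measurable_fun [set: X * X] (fun z => (K * err z.1)%:E).
  exact: (measurableT_comp mE measurable_fst).
have mE2 : measurable_fun [set: X * X] (fun z => (K * err z.2)%:E).
  exact: (measurableT_comp mE measurable_snd).
have intE (P : probability X R) : P.-integrable setT (EFin \o err) ->
    (\int[P]_x (K * err x)%:E = (K * \int[P]_x err x)%:E)%E.
  move=> iP; rewrite -RintegralZl// /Rintegral fineK//.
  have := integrableZl measurableT K iP.
  by move=> /(integrable_fin_num measurableT); rewrite /=; under eq_integral do rewrite -EFinM.
apply: (@le_trans _ _ (\int[pi]_z (k1 * G z)%:E)%E).
  apply: ge0_le_lower_integral => z; first by rewrite lee_fin sqr_ge0.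
  by rewrite lee_fin /G -mulrDr; exact: d_le.
under eq_integral do rewrite EFinM.
have mG1E : measurable_fun [set: X * X] (fun z => ((1 + eta) * G1 z)%:E).
  by apply/measurable_EFinP; apply: measurable_funM => //; exact: measurable_cst.
have G10 z : (0 <= ((1 + eta) * G1 z)%:E)%E.
  by rewrite lee_fin mulr_ge0// ?c0// ltW.
have GE : (\int[pi]_z (G z)%:E =
    ((1 + eta) * (\sum_i \sum_j p i j * c i j) + K * toterr)%:E)%E.
  transitivity (\int[pi]_z (((1 + eta) * G1 z)%:E + ((K * err z.1)%:E + (K * err z.2)%:E)))%E.
    by apply: eq_integral => z _; rewrite -!EFinD.
  rewrite ge0_integralD//; last 2 first.
  - by move=> z _; apply: adde_ge0.
  - exact: emeasurable_funD.
  rewrite ge0_integralD//.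
  rewrite (integral_coupling_fst cpl mE E0) (integral_coupling_snd cpl mE E0).
  rewrite !intE// -EFinD -mulrDr -/toterr EFinD; congr (_ + _)%E.
  under eq_integral do rewrite EFinM.
  rewrite ge0_integralZl_EFin//; first by rewrite G1E EFinM.
  - by move=> z _; rewrite lee_fin; exact: c0.
  - exact/measurable_EFinP.
  - exact: ltW.
rewrite ge0_integralZl_EFin//; last 2 first.
- move=> z _; rewrite lee_fin; have := G10 z; have := E0 z.1; have := E0 z.2.
  by rewrite !lee_fin /G => ? ? ?; rewrite !addr_ge0.
- apply/measurable_EFinP; apply: measurable_funD.
    by apply: measurable_funM => //; exact: measurable_cst.
  by apply: measurable_funD; exact/measurable_EFinP.
rewrite GE -EFinM lee_fin.
have -> : (1 + eta) ^+ 2 / lam * (H + 3 * ep) = k1 * ((1 + eta) * (H + 3 * ep)).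
  by rewrite /k1; field; rewrite gt_eqF.
rewrite ler_wpM2l//.
have le2 : \sum_i \sum_j p i j * c i j <= H + 2 * ep.
  by move: le dual Kerr; rewrite /a /b; lra.
have := ler_wpM2l (ltW eta1) le2; have := mulr_gt0 eta0 ep0.
by move: Kerr; lra.
Qed.

End cells.

Lemma W2sq_le_entropy (eta ep : R) : 0 < eta -> 0 < ep ->
  (W2sq d nu mu <= ((1 + eta) ^+ 2 / lam * (H + 3 * ep))%:E)%E.
Proof.
move=> eta0 ep0.
have X0 : [set: X] !=set0.
  apply/set0P/eqP => e; have := probability_setT mu; rewrite e measure0 => /eqP.
  by rewrite eq_sym onee_eq0.
have [s dense] : exists s : nat -> X, forall (e : R) x, 0 < e -> exists n, d x (s n) < e.
  by apply: dense_sequence => //; case: pd.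
pose K := 2 * lam / eta.
have K0 : 0 < K by rewrite /K divr_gt0// mulr_gt0.
(* Each measure contributes an error at most [2 * e ^+ 2], so that [K] times the total is at most
   [ep]. *)
pose e := Num.sqrt (ep / (4 * K)).
have e20 : 0 < ep / (4 * K) by rewrite divr_gt0// mulr_gt0.
have e0 : 0 < e by rewrite sqrtr_gt0.
have e2 : e ^+ 2 = ep / (4 * K) by rewrite sqr_sqrtr// ltW.
have mmu := second_moment pd lam_gt0 exp_le (s 0).
have mnu : nu.-integrable setT (EFin \o (fun x => d x (s 0) ^+ 2)).
  by apply: (second_moment_density pd lam_gt0 exp_le _ gd); rewrite HE ltry.
have dn x : exists n, d x (s n) < e by exact: dense.
have [n _ /(_ n (leqnn n)) [h1 h2]] :=
  filterI (cell_err_near pd e0 dn mnu) (cell_err_near pd e0 dn mmu).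
pose t x := Ordinal (cell_lt d s e n x).
have mt i : measurable (t @^-1` [set i]).
  rewrite (_ : _ @^-1` _ = [set x | cell d s e n x = i]).
    exact: measurable_cell_fibre.
  apply/seteqP; split=> x /=; first by move=> <-.
  by move=> h; apply: val_inj.
apply: (@W2sq_le_cells n.+1 t (fun i => s i) eta eta0 mt) => //.
- exact: (@measurable_cell_err _ _ _ d s e pd n).
- exact: (@integrable_cell_err _ _ _ d s e pd e0 nu n).
- exact: (@integrable_cell_err _ _ _ d s e pd e0 mu n).
apply: (@le_trans _ _ (K * (2 * e ^+ 2 + 2 * e ^+ 2))).
  by rewrite ler_pM2l//; exact: lerD.
rewrite e2 le_eqVlt; apply/orP; left; apply/eqP.
by field; rewrite gt_eqF.
Qed.

End near_optimal_coupling.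

(** * Choice of the parameters and conclusion *)

Theorem theorem3p3 (R : realType) (dd : measure_display) (X : measurableType dd)
  (d : X -> X -> R) (mu : probability X R) (lam0 D : R) :
  polish_borel d -> 0 < lam0 -> 0 < D ->
  (forall (nu : probability X R) (f : X -> R), inF d lam0 f ->
     (forall A, measurable A -> (nu A = \int[mu]_(x in A) (expR (f x))%:E)%E) ->
     (relent mu nu <= D%:E * fisher d mu f)%E) ->
  T2 d mu (Num.max (4 * D) lam0^-1).
Proof.
move=> pd lam00 D0 lsi nu; set C := Num.max _ _.
have C1 : 4 * D <= C by rewrite le_max lexx.
have C2 : lam0^-1 <= C by rewrite le_max lexx orbT.
have C0 : 0 < C by apply: lt_le_trans C1; rewrite mulr_gt0.
(* Dividing by [C] isolates the infimum in [relent], so that one density can be treated at a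
   time. *)
rewrite -lee_pdivrMl//; apply: le_ereal_inf_tmp => _ [g gd <-].
rewrite lee_pdivrMl//.
have Hge0 := entropy_ge0 gd.
have [Hoo|Hfin] := eqVneq (\int[mu]_x (g x * ln (g x))%:E)%E +oo%E.
  by rewrite Hoo gt0_muley ?lte_fin// leey.
have HE : (\int[mu]_x (g x * ln (g x))%:E)%E =
    (fine (\int[mu]_x (g x * ln (g x))%:E)%E)%:E.
  by rewrite fineK// ge0_fin_numE// ltey.
rewrite HE; move: HE Hge0; set H := fine _ => HE; rewrite HE lee_fin => H0.
rewrite -EFinM; apply/lee_addgt0Pr => e e0.
(* For [th <= 1], [(1 + th)^3 <= 1 + 7 th] and [(1 + 7 th)(H + 3 th) <= H + th (7 H + 24)]; the
   second entry makes the excess at most [e]. *)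
pose th := Num.min 1 (e / (C * (7 * H + 24))).
have den : 0 < C * (7 * H + 24) by rewrite mulr_gt0//; lra.
have th0 : 0 < th by rewrite lt_min ltr01 divr_gt0.
have th1 : th <= 1 by rewrite ge_min lexx.
have the : th * (C * (7 * H + 24)) <= e.
  by rewrite -ler_pdivlMr// ge_min lexx orbT.
(* Strictly below [C^-1], as [inF] requires [lam < lam0] while [C^-1] may equal [lam0]. *)
pose lam := ((1 + th) * C)^-1.
have th10 : 0 < 1 + th by lra.
have lam_gt0 : 0 < lam by rewrite invr_gt0 mulr_gt0.
have lam_C : lam < C^-1.
  by rewrite ltf_pV2 ?posrE ?mulr_gt0// ltr_pMl// ltrDl.
have lam_lt : lam < lam0.
  by apply: (lt_le_trans lam_C); rewrite invf_ple ?posrE.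
have lamD : 4 * D * lam <= 1.
  apply: (@le_trans _ _ (C * C^-1)); last by rewrite mulfV ?gt_eqF.
  by apply: ler_pM => //; [rewrite mulr_ge0// ltW|exact: ltW|exact: ltW].
have exp_le (h : X -> R) : bmfun h ->
    \int[mu]_x expR (infconv d lam h x) <= expR (\int[mu]_x h x).
  move=> [mh [M hM]].
  exact: (exp_infconv_le pd D0 lam_gt0 lam_lt lamD lsi mh hM).
apply: (le_trans (W2sq_le_entropy pd lam_gt0 exp_le gd HE th0 th0)).
rewrite -EFinD lee_fin /lam invrK.
have q1 : (1 + th) ^+ 3 <= 1 + 7 * th by nra.
have -> : (1 + th) ^+ 2 * ((1 + th) * C) * (H + 3 * th) =
  (1 + th) ^+ 3 * (C * (H + 3 * th)) by ring.
have q2 : 0 <= C * (H + 3 * th) by rewrite mulr_ge0//; lra.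
apply: (le_trans (ler_wpM2r q2 q1)).
have q3 : C * th ^+ 2 <= C * th by rewrite ler_pM2l// expr2 ger_pMl.
by move: the q3; nra.
Qed.
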